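(* Let $V$ be a valuation ring with maximal ideal $\mathfrak{m}$ and residue field $F=V/\mathfrak{m}$, containing a field $k$, and let $k'$ be a field extension of $k$. Put $V'=k'\otimes_k V$ and $F'=k'\otimes_k F=V'/\mathfrak{m}V'$. Let $\overline{\mathfrak{p}}$ be a minimal prime ideal of $F'$, let $\mathfrak{p}$ be the prime ideal of $V'$ containing $\mathfrak{m}V'$ with $\overline{\mathfrak{p}}=\mathfrak{p}/\mathfrak{m}V'$, let $x$ be the point of $\mathrm{Spec}(V')$ (or of $\mathrm{Spec}(F')$) corresponding to $\mathfrak{p}$, and let $W:=V'_{\mathfrak{p}}$, whose residue field is $\kappa(x)$. Assume that $x$ is a strictly maximal point of $\mathrm{Spec}(F')$. Then: (1) $W$ is a weakly unramified extension of $V$. (2) The natural morphism $\mathrm{Spec}(W)\to\mathrm{Spec}(V)$ is a homeomorphism; moreover, for every prime ideal $\mathfrak{q}$ of $V$, the unique prime ideal of $W$ above $\mathfrak{q}$ is $\mathfrak{q}':=\mathfrak{q}W$, and its residue field $\kappa(\mathfrak{q}')$ is a strictly maximal composite extension of $k'$ and $\kappa(\mathfrak{q})$ over $k$. (3) If the extension $k'/k$ is separable, then so is $\kappa(x)/F$, and more generally (with $\mathfrak{q}'=\mathfrak{q}W$) so is $\kappa(\mathfrak{q}')/\kappa(\mathfrak{q})$ for every $\mathfrak{q}\in\mathrm{Spec}(V)$. (4) If the extension $F/k$ is separable, then so is $\kappa(x)/k'$, and more generally so is $\kappa(\mathfrak{q}')/k'$ for every $\mathfrak{q}'\in\mathr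m{Spec}(W)$.
   Context: Rings are commutative with unit; $\kappa(\cdot)$ denotes the residue field at a point or prime ideal. The value group of a valuation ring $V$ with fraction field $K$ is $K^\times/V^\times$. An extension of a valuation ring $V$ is an injective local homomorphism $V\to W$ with $W$ a valuation ring; it is weakly unramified if the induced injective homomorphism of value groups is an isomorphism. A maximal point of a scheme is the generic point of an irreducible component. A point $x$ of a scheme $X$ is strictly maximal if the local ring $\mathcal{O}_{X,x}$ is a field (equivalently, $\mathcal{O}_{X,x}$ is reduced and $x$ is a maximal point of $X$; equivalently, the canonical morphism $\mathrm{Spec}(\kappa(x))\to X$ is flat). A composite extension of two extensions $L,M$ of a field $K$ is a triple $(E,u,v)$ where $E$ is an extension of $K$ and $u:L\to E$, $v:M\to E$ are $K$-embeddings such that $u(L)\cup v(M)$ generates $E$ as a field. The kernel of $u\otimes v: L\otimes_K M\to E$ defines a point of $\mathrm{Spec}(L\otimes_K M)$ with residue field isomorphic to $E$; the composite extension is called strictly maximal (over $K$) if this point is a strictly maximal point of $\mathrm{Spec}(L\otimes_K M)$. A (not necessarily algebraic) field extension $L/K$ is separable if $L\otimes_K K'$ is reduced for every field extension $K'$ of $K$. *)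

(* Defs.v *)
From HB Require Import structures.
From mathcomp Require Import all_boot all_algebra.
From mathcomp Require Import generic_quotient ring_quotient.
From mathcomp Require Import all_classical topology.

Set Implicit Arguments.
Unset Strict Implicit.
Unset Printing Implicit Defensive.

Import GRing.Theory.
Local Open Scope classical_set_scope.
Local Open Scope quotient_scope.
Local Open Scope ring_scope.

(* Tensor products, localizations, residue fields and fraction fields are      *)
(* predicates on ring morphisms. Each of these objects exists and is unique up *)
(* to unique isomorphism, so that a notion defined below with "exists" over    *)
(* models does not depend on the model. All the rings that occur are nonzero,  *)
(* hence comNzRingType.                                                        *)

(* idealr_closed includes 1 \notin I *)
Record spec (R : comNzRingType) := Spec {
  spec_pred :> {pred R};
  spec_ideal : idealr_closed spec_pred;
  spec_prime : prime_idealr_closed spec_pred }.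

Lemma spec_eqP (R : comNzRingType) (p q : spec R) : p =i q -> p = q.
Proof.
case: p => P hP hP'; case: q => Q hQ hQ' PQ.
have {PQ}PQ : P = Q by apply/funext => x; exact: PQ.
case: _ / PQ hQ hQ' => hQ hQ'.
by rewrite (Prop_irrelevance hP hQ) (Prop_irrelevance hP' hQ').
Qed.

HB.instance Definition _ (R : comNzRingType) := gen_eqMixin (spec R).
HB.instance Definition _ (R : comNzRingType) := gen_choiceMixin (spec R).

Section Zariski.
Variable R : comNzRingType.

Definition zero_locus (E : set R) : set (spec R) :=
  [set p : spec R | forall x, E x -> x \in p].

Definition zariski_open (U : set (spec R)) : Prop :=
  exists E : set R, U = ~` zero_locus E.

Let zariski_openT : zariski_open setT.
Proof.
exists [set 1]; rewrite -[LHS]setC0; congr (~` _).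
apply/seteqP; split=> // p /(_ 1 erefl) p1.
by have [_ /negP + _] := spec_ideal p; apply.
Qed.

Let zariski_openI (A B : set (spec R)) :
  zariski_open A -> zariski_open B -> zariski_open (A `&` B).
Proof.
move=> [E ->] [E' ->].
exists [set z | exists x y, [/\ E x, E' y & z = x * y]].
rewrite -setCU; congr (~` _); apply/seteqP; split=> p.
  have [_ _ pI] := spec_ideal p.
  have mulp a x : x \in p -> a * x \in p.
    have [p0 _ _] := spec_ideal p.
    by move=> px; rewrite -[_ * _]addr0; apply: pI.
  case=> h z [x [y [Ex Ey ->]]]; last exact/mulp/h.
  by rewrite mulrC; apply/mulp/h.
move=> h; apply: contrapT => /not_orP[] /existsNP[x] /not_implyP[Ex nx].
move=> /existsNP[y] /not_implyP[Ey ny].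
by have /(spec_prime (s := p))/orP[] : x * y \in p by apply: h; exists x, y.
Qed.

Let zariski_open_bigU (I : Type) (f : I -> set (spec R)) :
  (forall i, zariski_open (f i)) -> zariski_open (\bigcup_i f i).
Proof.
move=> /choice[E fE]; exists (\bigcup_i E i).
rewrite (eq_bigcupr (fun i _ => fE i)) -setC_bigcap; congr (~` _).
apply/seteqP; split=> p.
  by move=> h x [i _ Ex]; apply: (h i).
by move=> h i _ x Ex; apply: h; exists i.
Qed.

HB.instance Definition _ := isOpenTopological.Build (spec R)
  zariski_openT zariski_openI zariski_open_bigU.

End Zariski.

Section SpecMap.
Variables (R S : comNzRingType) (f : {rmorphism R -> S}) (p : spec S).

Let preim_ideal : idealr_closed [pred x : R | f x \in p].
Proof.
have [p0 p1 pI] := spec_ideal p.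
split; rewrite ?inE ?rmorph0 ?rmorph1 //.
by move=> a u v; rewrite !inE rmorphD rmorphM; apply: pI.
Qed.

Let preim_prime : prime_idealr_closed [pred x : R | f x \in p].
Proof. by move=> u v; rewrite !inE rmorphM; apply: spec_prime. Qed.

Definition spec_map : spec R := Spec preim_ideal preim_prime.

End SpecMap.

Section Kernel.
Variables (R : comNzRingType) (E : fieldType) (h : {rmorphism R -> E}).

Let ker_ideal : idealr_closed [pred x : R | h x == 0].
Proof.
split; rewrite ?inE ?rmorph0 ?rmorph1 ?oner_eq0 //.
move=> a u v; rewrite !inE rmorphD rmorphM => /eqP-> /eqP->.
by rewrite mulr0 addr0.
Qed.

Let ker_prime : prime_idealr_closed [pred x : R | h x == 0].
Proof. by move=> u v; rewrite !inE rmorphM mulf_eq0. Qed.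

Definition ker_point : spec R := Spec ker_ideal ker_prime.

End Kernel.

Definition homeomorphism (X Y : topologicalType) (f : X -> Y) : Prop :=
  [/\ bijective f, continuous f & forall U : set X, open U -> open (f @` U)].

Definition minimal_prime (R : comNzRingType) (p : spec R) : Prop :=
  forall q : spec R, {subset q <= p} -> q = p.

Definition extension_ideal (R S : comNzRingType) (f : R -> S) (I : {pred R}) :
    set S :=
  [set y | exists n (s : 'I_n -> S) (x : 'I_n -> R),
     (forall j, x j \in I) /\ y = \sum_j s j * f (x j)].

Definition localization_at (R : comNzRingType) (p : spec R)
    (S : comUnitRingType) (f : {rmorphism R -> S}) : Prop :=
  [/\ forall s, s \notin p -> f s \is a GRing.unit,
      forall y, exists a s, s \notin p /\ y = f a / f s
    & forall a b, f a = f b -> exists2 s, s \notin p & s * a = s * b].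

(* the local ring at p is a field *)
Definition strictly_maximal (R : comNzRingType) (p : spec R) : Prop :=
  exists (Q : fieldType) (f : {rmorphism R -> Q}), localization_at p f.

(* f identifies K with the fraction field of R/p *)
Definition residue_field_at (R : comNzRingType) (p : spec R)
    (K : fieldType) (f : {rmorphism R -> K}) : Prop :=
  ker_point f = p /\
  forall y, exists a b, f b != 0 /\ y = f a / f b.

(* f identifies F with the quotient of the local ring R by its maximal ideal *)
Definition residue_field_of_local (R : comUnitRingType)
    (F : fieldType) (f : {rmorphism R -> F}) : Prop :=
  (forall a, (f a == 0) = (a \isn't a GRing.unit)) /\
  (forall y, exists a, f a = y).

Definition fraction_field (R : comNzRingType)
    (K : fieldType) (f : {rmorphism R -> K}) : Prop :=
  injective f /\ forall y, exists a b, f b != 0 /\ y = f a / f b.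

(* T, with x (x) y := a x * b y, has the universal property of the tensor      *)
(* product over K of the K-modules A and B; its multiplication is then the     *)
(* usual one since a and b are ring morphisms.                                 *)
Definition tensor_product (K A B T : comNzRingType)
    (phi : {rmorphism K -> A}) (psi : {rmorphism K -> B})
    (a : {rmorphism A -> T}) (b : {rmorphism B -> T}) : Prop :=
  (forall c, a (phi c) = b (psi c)) /\
  forall (M : zmodType) (m : A -> B -> M),
    (forall x, {morph m x : y z / y + z}) ->
    (forall y, {morph m^~ y : x z / x + z}) ->
    (forall c x y, m (phi c * x) y = m x (psi c * y)) ->
  exists2 g : {additive T -> M},
    forall x y, g (a x * b y) = m x y
    & forall g' : {additive T -> M},
        (forall x y, g' (a x * b y) = m x y) -> g' =1 g.

Definition reduced (R : comNzRingType) : Prop :=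
  forall (x : R) n, x ^+ n = 0 -> x = 0.

Definition separable_ext (K L : fieldType) (phi : {rmorphism K -> L}) : Prop :=
  forall (K' : fieldType) (psi : {rmorphism K -> K'}),
  exists (T : comNzRingType) (a : {rmorphism L -> T}) (b : {rmorphism K' -> T}),
    tensor_product phi psi a b /\ reduced T.

(* divring_closed predicates on a field are its subfields *)
Definition composite_ext (K L M E : fieldType)
    (phi : {rmorphism K -> L}) (psi : {rmorphism K -> M})
    (u : {rmorphism L -> E}) (v : {rmorphism M -> E}) : Prop :=
  (forall c, u (phi c) = v (psi c)) /\
  forall S : {pred E}, divring_closed S ->
    (forall x, u x \in S) -> (forall y, v y \in S) -> forall z, z \in S.

(* h is the morphism u (x) v *)
Definition strictly_maximal_composite (K L M E : fieldType)
    (phi : {rmorphism K -> L}) (psi : {rmorphism K -> M})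
    (u : {rmorphism L -> E}) (v : {rmorphism M -> E}) : Prop :=
  composite_ext phi psi u v /\
  exists (T : comNzRingType) (a : {rmorphism L -> T}) (b : {rmorphism M -> T})
         (h : {rmorphism T -> E}),
    [/\ tensor_product phi psi a b, h \o a =1 u, h \o b =1 v
      & strictly_maximal (ker_point h)].

(* Fields are valuation rings. *)
Definition valuation_ring (R : comUnitRingType) : Prop :=
  exists (K : fieldType) (i : {rmorphism R -> K}),
    fraction_field i /\
    forall x : K, (exists a, x = i a) \/ (exists a, x^-1 = i a).

Section ValueGroup.
Variables (R : comUnitRingType) (K : fieldType) (i : {rmorphism R -> K}).

Definition value_eqv (x y : {z : K | z != 0}) : bool :=
  `[< exists2 u : R, u \is a GRing.unit & val y = i u * val x >].

Let value_eqv_refl : reflexive value_eqv.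
Proof. by move=> x; apply/asboolP; exists 1; rewrite ?unitr1 ?rmorph1 ?mul1r. Qed.

Let value_eqv_imp x y : value_eqv x y -> value_eqv y x.
Proof.
move=> /asboolP[u uU xy]; apply/asboolP; exists u^-1; rewrite ?unitrV //.
by rewrite xy mulrA -rmorphM mulVr // rmorph1 mul1r.
Qed.

Let value_eqv_sym : symmetric value_eqv.
Proof. by move=> x y; apply/idP/idP; apply: value_eqv_imp. Qed.

Let value_eqv_trans : transitive value_eqv.
Proof.
move=> y x z /asboolP[u uU xy] /asboolP[v vU yz]; apply/asboolP.
by exists (v * u); rewrite ?unitrM ?uU ?vU // yz xy mulrA rmorphM.
Qed.

Canonical value_equiv :=
  EquivRel value_eqv value_eqv_refl value_eqv_sym value_eqv_trans.

(* K^x / R^x *)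
Definition value_group := {eq_quot value_equiv}.

End ValueGroup.

Section ValueGroupMap.
Variables (R S : comUnitRingType) (K L : fieldType).
Variables (i : {rmorphism R -> K}) (j : {rmorphism S -> L}).
Variables (f : {rmorphism R -> S}) (g : {rmorphism K -> L}).

Let g_nz (x : {z : K | z != 0}) : g (val x) != 0.
Proof. by rewrite fmorph_eq0; exact: (valP x). Qed.

Definition nonzero_map (x : {z : K | z != 0}) : {z : L | z != 0} :=
  exist _ (g (val x)) (g_nz x).

Definition value_group_map (x : value_group i) : value_group j :=
  \pi_(value_group j) (nonzero_map (repr x)).

Lemma value_group_mapE : (forall a, g (i a) = j (f a)) ->
  forall x, value_group_map (\pi_(value_group i) x) =
            \pi_(value_group j) (nonzero_map x).
Proof.
move=> gi x; apply/eqP; rewrite eqmodE /=; apply/asboolP.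
have /eqP := reprK (\pi_(value_group i) x); rewrite eqmodE /=.
move=> /asboolP[u uU /= xE]; exists (f u); first exact: rmorph_unit.
by rewrite /= xE rmorphM gi.
Qed.

End ValueGroupMap.

(* value_group_map is induced by g, hence is a group morphism, so that it is   *)
(* an isomorphism if and only if it is bijective.                              *)
Definition weakly_unramified_extension (R S : comUnitRingType)
    (f : {rmorphism R -> S}) : Prop :=
  [/\ valuation_ring R /\ valuation_ring S,
      injective f,
      forall a, f a \is a GRing.unit -> a \is a GRing.unit
    & exists (K L : fieldType) (i : {rmorphism R -> K}) (j : {rmorphism S -> L})
             (g : {rmorphism K -> L}),
        [/\ fraction_field i, fraction_field j, g \o i =1 j \o f
          & bijective (@value_group_map R S K L i j g)]].

(* Main.v *)
Require Import Defs.
From HB Require Import structures.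
From mathcomp Require Import all_boot all_algebra.
From mathcomp Require Import generic_quotient fraction.
From mathcomp Require Import all_classical topology.

Set Implicit Arguments.
Unset Strict Implicit.
Unset Printing Implicit Defensive.

Import GRing.Theory.
Local Open Scope ring_scope.

(** All four conclusions rest on one fact: every element of W is an element of
    V times a unit of W ([localization_monomial]). Divisibility in W is then
    divisibility in V, which makes W a valuation ring with the value group of
    V and makes extension of ideals a bijection between the two spectra.

    The fact is proved by enlarging a subfield S of k', from the image of k to
    k' itself, for which it holds with S (x) V in place of V'; by Zorn's lemma
    it suffices to pass from S to S(z). The local ring U of S (x) V at the
    contraction of p is then a valuation ring. If z is transcendental over S,
    the content of a polynomial in z with coefficients in U can be factored
    out, and what remains is a unit because the powers of z stay independent
    over the residue field of U ([monomial_transcendental]). If z is algebraic,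
    the elements g of U such that g divides w x for some x outside p form, by
    elimination over U, a family with a largest member ([largest_divisor]).
    The quotient of w by that member is a unit: a non-unit of W is divisible
    by some c in the maximal ideal of V, since the local ring of F' at x being
    a field means that the maximal ideal of V generates that of W, and c would
    enlarge the divisor ([monomial_algebraic]). Descent from V' to S(z) (x) V
    uses S(z)-linear functionals on k' ([projector_separates]).

    For q in Spec V and q' = q W, an element of k' (x) kappa(q) that vanishes in
    kappa(q') is killed by an element that does not, because an element of q'
    is a multiple of an element of q ([composite_tensor]). Thus kappa(q') is
    a localization of k' (x) kappa(q), and for every extension N of kappa(q)
    the ring kappa(q') (x) N over kappa(q) is a localization of k' (x) N over k
    and inherits its reducedness ([separable_localizes]). With the two factors
    exchanged the same argument gives the separability of kappa(q') over k' as
    soon as kappa(q) is separable over k, which follows from the separability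
    of F over k by a content argument ([residue_separable]). *)

(** * Functionals over a subfield *)

(** A predicate rather than a type: the image of a field in a larger ring and
    the subfields of k' over which the induction runs are treated alike. *)
Definition subfield_in (A : comNzRingType) (S : {pred A}) : Prop :=
  [/\ 1 \in S, {in S &, forall x y, x - y \in S},
      {in S &, forall x y, x * y \in S}
    & {in S, forall x, x != 0 -> exists2 y, y \in S & x * y = 1}].

(** The values stay in A, so that a functional can be applied to the left
    factors of a tensor. *)
Definition functional (A : comNzRingType) (S : {pred A}) (lam : A -> A) : Prop :=
  [/\ {morph lam : x y / x + y}, {in S, forall c x, lam (c * x) = c * lam x}
    & forall x, lam x \in S].

Section SubfieldTheory.
Variables (A : comNzRingType) (S : {pred A}).
Hypothesis S_subfield : subfield_in S.

Lemma subfield1 : 1 \in S. Proof. by case: S_subfield. Qed.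

Lemma subfieldM : {in S &, forall x y, x * y \in S}.
Proof. by case: S_subfield. Qed.

Lemma subfieldB : {in S &, forall x y, x - y \in S}.
Proof. by case: S_subfield. Qed.

Lemma subfield0 : 0 \in S.
Proof. by rewrite -(subrr 1); apply: subfieldB; exact: subfield1. Qed.

Lemma subfieldN : {in S, forall x, - x \in S}.
Proof. by move=> x xS; rewrite -sub0r; apply: subfieldB => //; exact: subfield0. Qed.

Lemma subfieldD : {in S &, forall x y, x + y \in S}.
Proof. by move=> x y xS yS; rewrite -[y]opprK; apply/subfieldB/subfieldN. Qed.

Lemma subfieldV : {in S, forall x, x != 0 -> exists2 y, y \in S & x * y = 1}.
Proof. by case: S_subfield. Qed.

(** A subspace that is maximal among those that contain U and avoid x has the
    line of x as a complement, and the coordinate along x is the functional. *)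
Lemma exists_functional (U : A -> Prop) (x : A) :
    U 0 -> (forall y z, U y -> U z -> U (y + z)) ->
    (forall c y, c \in S -> U y -> U (c * y)) -> ~ U x ->
  exists lam, [/\ functional S lam, lam x = 1 & forall y, U y -> lam y = 0].
Proof.
move=> U0 UD UZ Ux.
(* The subspace is the union of U and X, so that the empty chain is harmless. *)
pose P (X : set A) := ~ X x /\
  forall c y z, c \in S -> U y \/ X y -> U z \/ X z -> U (c * y + z) \/ X (c * y + z).
have [|X [[Xx XP] maxX]] := @Zorn_bigcup A P.
  move=> F FP Ftot; split.
    by move=> [X FX /=]; case: (FP X FX).
  move=> c y z cS [Uy|[X FX Xy]] [Uz|[Y FY Yz]].
  - by left; apply/UD/Uz/UZ.
  - have [_ h] := FP _ FY.
    by case: (h c y z cS (or_introl Uy) (or_intror Yz)); [left|right; exists Y].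
  - have [_ h] := FP _ FX.
    by case: (h c y z cS (or_intror Xy) (or_introl Uz)); [left|right; exists X].
  - have [XY|YX] := Ftot _ _ FX FY.
    + have [_ h] := FP _ FY.
      case: (h c y z cS (or_intror (XY _ Xy)) (or_intror Yz)); first by left.
      by right; exists Y.
    + have [_ h] := FP _ FX.
      case: (h c y z cS (or_intror Xy) (or_intror (YX _ Yz))); first by left.
      by right; exists X.
pose H y := U y \/ X y.
have HP c y z : c \in S -> H y -> H z -> H (c * y + z) by exact: XP.
have H0 : H 0 by left.
have HZ c y : c \in S -> H y -> H (c * y).
  by move=> cS Hy; rewrite -[_ * _]addr0; apply: HP.
have HD y z : H y -> H z -> H (y + z).
  by move=> Hy Hz; rewrite -[y]mul1r; apply: HP => //; exact: subfield1.
have HB y z : H y -> H z -> H (y - z).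
  move=> Hy Hz; rewrite addrC -mulN1r; apply: HP => //.
  by apply: subfieldN; exact: subfield1.
have Hx : ~ H x by case.
have coord z : exists c, c \in S /\ H (z - c * x).
  have [Hz|Hz] := pselect (H z).
    by exists 0; rewrite mul0r subr0; split => //; exact: subfield0.
  pose Y : set A := fun t => exists c, c \in S /\ H (t - c * z).
  have HY t : H t -> Y t.
    by move=> Ht; exists 0; rewrite mul0r subr0; split=> //; exact: subfield0.
  have XY : (X `<` Y)%classic.
    split; first by move=> t Xt; apply: HY; right.
    move=> YX; apply: Hz; right; apply: YX.
    by exists 1; rewrite mul1r subrr; split=> //; exact: subfield1.
  have /not_andP[/contrapT[c [cS Hxz]]|nYP] := maxX _ XY.
    have c0 : c != 0 by apply: contraPneq Hxz => ->; rewrite mul0r subr0.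
    have [d dS cd] := subfieldV cS c0.
    exists d; split=> //.
    have -> : z - d * x = - d * (x - c * z) + 0.
      by rewrite addr0 mulrBr !mulNr opprK addrC mulrA [d * c]mulrC cd mul1r.
    by apply: HP => //; apply: subfieldN.
  exfalso; apply: nYP => c y t cS Hy Ht; right.
  have YH u : U u \/ Y u -> Y u by case=> // Uu; apply: HY; left.
  have [e [eS He]] := YH _ Hy; have [f [fS Hf]] := YH _ Ht.
  exists (c * e + f); split; first by apply: subfieldD => //; exact: subfieldM.
  have -> : c * y + t - (c * e + f) * z = c * (y - e * z) + (t - f * z).
    by rewrite mulrBr mulrDl opprD mulrA addrACA.
  exact: HP.
have uniq c d z : c \in S -> d \in S -> H (z - c * x) -> H (z - d * x) -> c = d.
  move=> cS dS Hc Hd; apply: contrapT => /eqP; rewrite -subr_eq0 => cd.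
  have [e eS cde] := subfieldV (subfieldB cS dS) cd.
  apply: Hx; rewrite -[x]mul1r -cde mulrC mulrA [x * _]mulrC [_ * e]mulrC.
  apply: HZ => //.
  have -> : (c - d) * x = (z - d * x) - (z - c * x).
    by rewrite mulrBl opprB [RHS]addrC subrKA.
  exact: HB.
have [lam lamP] := choice coord; have lamS z := (lamP z).1.
exists lam; split; first split => //.
- move=> y z; apply: (uniq _ _ (y + z)) => //; first exact: subfieldD.
    exact: (lamP _).2.
  by rewrite mulrDl opprD addrACA; apply: HD; apply: (lamP _).2.
- move=> c cS y; apply: (uniq _ _ (c * y)) => //; first exact: subfieldM.
    exact: (lamP _).2.
  by rewrite -mulrA -mulrBr; apply: HZ => //; apply: (lamP _).2.
- apply: (uniq _ _ x) => //; [exact: subfield1|exact: (lamP _).2|].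
  by rewrite mul1r subrr.
- move=> y Uy; apply: (uniq _ _ y) => //; [exact: subfield0|exact: (lamP _).2|].
  by rewrite mul0r subr0; left.
Qed.

Fixpoint in_span (s : seq A) (x : A) : Prop :=
  if s is y :: s' then exists2 c, c \in S & in_span s' (x - c * y) else x = 0.

Lemma in_span0 s : in_span s 0.
Proof.
elim: s => //= y s IH; exists 0; first exact: subfield0.
by rewrite mul0r subr0.
Qed.

Lemma in_spanD s x y : in_span s x -> in_span s y -> in_span s (x + y).
Proof.
elim: s x y => [|z s IH] /= x y; first by move=> -> ->; rewrite addr0.
move=> [c cS xc] [d dS yd]; exists (c + d); first exact: subfieldD.
by rewrite mulrDl opprD addrACA; apply: IH.
Qed.

Lemma in_spanZ s c x : c \in S -> in_span s x -> in_span s (c * x).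
Proof.
move=> cS; elim: s x => [|z s IH] /= x; first by move=> ->; rewrite mulr0.
move=> [d dS xd]; exists (c * d); first exact: subfieldM.
by rewrite -mulrA -mulrBr; apply: IH.
Qed.

Lemma in_span_mem s x : x \in s -> in_span s x.
Proof.
elim: s => //= y s IH; rewrite inE => /predU1P[->|xs].
  by exists 1; rewrite ?mul1r ?subrr; [exact: subfield1|exact: in_span0].
by exists 0; rewrite ?mul0r ?subr0; [exact: subfield0|exact: IH].
Qed.

Section Balanced.
Variables (N : zmodType) (act : A -> N -> N).

Definition balanced (M : zmodType) (m : A -> N -> M) : Prop :=
  [/\ forall x, {morph m x : y z / y + z}, forall y, {morph m^~ y : x z / x + z}
    & {in S, forall c x y, m (c * x) y = m x (act c y)}].

(** The term x (x) n is distributed over the others, which does not lengthen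
    the list. *)
Lemma absorb_span (s : seq (A * N)) x n : in_span (map fst s) x ->
  exists2 s' : seq (A * N), size s' = size s &
    forall (M : zmodType) (m : A -> N -> M), balanced m ->
      \sum_(z <- s') m z.1 z.2 = m x n + \sum_(z <- s) m z.1 z.2.
Proof.
elim: s x => [|[y n'] s IH] x /=.
  move=> ->; exists [::] => // M m [_ mD _].
  rewrite !big_nil addr0; apply/esym/eqP.
  by rewrite -[eqbLHS](addrK (m 0 n)) -mD addr0 subrr.
move=> [c cS /IH[s' ss' E]]; exists ((y, n' + act c n) :: s'); first by rewrite /= ss'.
move=> M m mb; have [mDr mDl mS] := mb.
have -> : m x n = m (c * y) n + m (x - c * y) n by rewrite -mDl [c * y + _]addrC subrK.
by rewrite !big_cons /= E // mDr mS // [m y n' + _]addrC addrACA.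
Qed.

(** Reduction of a formal tensor whose contractions all lie in J: as long as
    one of the left factors is a combination of the others the tensor can be
    shortened, and otherwise some functional isolates a coefficient. *)
Lemma coefficients_in (J : N -> Prop) (s : seq (A * N)) :
    (forall c d y, c \in S -> d \in S -> act (c * d) y = act c (act d y)) ->
    (forall c d y, c \in S -> d \in S -> act (c + d) y = act c y + act d y) ->
    (forall c, {morph act c : x y / x + y}) ->
    (forall y, act 1 y = y) ->
    J 0 -> (forall y z, J y -> J z -> J (y - z)) ->
    (forall c y, c \in S -> J y -> J (act c y)) ->
    (forall lam, functional S lam -> J (\sum_(z <- s) act (lam z.1) z.2)) ->
  exists2 s' : seq (A * N), forall z, z \in map snd s' -> J z &
    forall (M : zmodType) (m : A -> N -> M), balanced m ->
      \sum_(z <- s') m z.1 z.2 = \sum_(z <- s) m z.1 z.2.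
Proof.
move=> actM actDl actDr act1 J0 JB JZ.
have lam_bal lam : functional S lam -> balanced (fun x y => act (lam x) y).
  move=> [lamD lamZ lamS]; split=> [x y z|y x z|c cS x y]; rewrite ?actDr //.
    by rewrite lamD actDl.
  by rewrite lamZ // mulrC actM.
have [n] := ubnP (size s); elim: n s => // n IH [|[x y] s] /= lesn sJ.
  by exists [::].
have [xs|xs] := pselect (in_span (map fst s) x).
  have [s' ss' E] := absorb_span y xs.
  have [||s'' sJ'' E''] := IH s'.
  - by rewrite ss'.
  - by move=> lam flam; rewrite (E _ _ (lam_bal _ flam)); have := sJ _ flam; rewrite big_cons.
  - by exists s'' => // M m mb; rewrite E'' // E // big_cons.
have [lam [flam lamx lams]] := exists_functional (in_span0 _) (@in_spanD _)
  (fun c y cS => @in_spanZ _ c y cS) xs.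
have Jy : J y.
  have := sJ _ flam; rewrite big_cons /= lamx act1 big_seq big1 ?addr0 // => z zs.
  rewrite lams; last exact/in_span_mem/map_f.
  have : act (0 + 0) z.2 = act 0 z.2 + act 0 z.2 by apply: actDl; exact: subfield0.
  by rewrite addr0 => /eqP; rewrite eq_sym -subr_eq0 addrK => /eqP.
have [||s' sJ' E] := IH s; first by [].
  move=> mu fmu; have := sJ _ fmu; rewrite big_cons /= => /JB/(_ (JZ _ _ _ Jy)).
  by move=> /(_ (mu x)); rewrite [_ + _ - _]addrC addKr; apply; case: fmu.
exists ((x, y) :: s'); first by move=> z; rewrite inE => /predU1P[->|/sJ'].
by move=> M m mb; rewrite !big_cons E.
Qed.

End Balanced.
End SubfieldTheory.

(** * The tensor product as a ring of functions *)

Lemma morph_add0 (M N : zmodType) (f : M -> N) : {morph f : x y / x + y} -> f 0 = 0.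
Proof. by move=> fD; apply: (addrI (f 0)); rewrite -fD !addr0. Qed.

Lemma morph_add_sum (M N : zmodType) (f : M -> N) (I : Type) (s : seq I) (F : I -> M) :
  {morph f : x y / x + y} -> f (\sum_(i <- s) F i) = \sum_(i <- s) f (F i).
Proof. by move=> fD; apply: (big_morph f fD (morph_add0 fD)). Qed.

Section TensorModel.
Variables (K : fieldType) (A B : comNzRingType).
Variables (phi : {rmorphism K -> A}) (psi : {rmorphism K -> B}).

Definition image_of : {pred A} := [pred x | `[< exists c, x = phi c >]].

Lemma image_ofP x : reflect (exists c, x = phi c) (x \in image_of).
Proof. exact: asboolP. Qed.

Lemma mem_image_of c : phi c \in image_of.
Proof. by apply/image_ofP; exists c. Qed.

Lemma image_subfield : subfield_in image_of.
Proof.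
split.
- by rewrite -(rmorph1 phi) mem_image_of.
- move=> _ _ /image_ofP[c ->] /image_ofP[d ->]; rewrite -rmorphB; exact: mem_image_of.
- move=> _ _ /image_ofP[c ->] /image_ofP[d ->]; rewrite -rmorphM; exact: mem_image_of.
- move=> _ /image_ofP[c ->] c0; exists (phi c^-1); first exact: mem_image_of.
  rewrite -rmorphM divff ?rmorph1 //.
  by apply: contra_neq c0 => ->; rewrite rmorph0.
Qed.

(** Linearity over K, where K acts on A and B through phi and psi. *)
Definition klinear (f : A -> B) : Prop :=
  {morph f : x y / x + y} /\ forall c x, f (phi c * x) = psi c * f x.

Definition kbalanced (M : zmodType) (m : A -> B -> M) : Prop :=
  [/\ forall x, {morph m x : y z / y + z}, forall y, {morph m^~ y : x z / x + z}
    & forall c x y, m (phi c * x) y = m x (psi c * y)].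

Lemma scalar_part : exists f : A -> K, forall c, f (phi c) = c.
Proof.
have h x : exists c, forall d, x = phi d -> c = d.
  have [[c ->]|nx] := pselect (exists c, x = phi c).
    by exists c => d /fmorph_inj.
  by exists 0 => d xd; case: nx; exists d.
by have [f fP] := choice h; exists f => c; apply: fP.
Qed.

Lemma functional_scalar lam : functional image_of lam ->
  exists2 mu : A -> K, (forall x, lam x = phi (mu x))
    & {morph mu : x y / x + y} /\ forall c x, mu (phi c * x) = c * mu x.
Proof.
move=> [lamD lamZ lamS].
have h x : exists c, lam x = phi c by apply/image_ofP.
have [mu muE] := choice h.
exists mu => //; split=> [x y|c x]; apply: (fmorph_inj phi).
  by rewrite rmorphD -!muE lamD.
by rewrite rmorphM -!muE lamZ // mem_image_of.
Qed.

Lemma coefficients_in_klinear (J : B -> Prop) (s : seq (A * B)) :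
    J 0 -> (forall y z, J y -> J z -> J (y - z)) ->
    (forall c y, J y -> J (psi c * y)) ->
    (forall f, klinear f -> J (\sum_(z <- s) f z.1 * z.2)) ->
  exists2 s' : seq (A * B), forall z, z \in map snd s' -> J z &
    forall (M : zmodType) (m : A -> B -> M), kbalanced m ->
      \sum_(z <- s') m z.1 z.2 = \sum_(z <- s) m z.1 z.2.
Proof.
move=> J0 JB JZ sJ; have [sc scE] := scalar_part.
pose act x (y : B) := psi (sc x) * y.
have [||||||s' sJ' E] := @coefficients_in _ _ image_subfield B act J s _ _ _ _ J0 JB.
- by move=> _ _ y /image_ofP[c ->] /image_ofP[d ->]; rewrite /act -rmorphM !scE rmorphM mulrA.
- by move=> _ _ y /image_ofP[c ->] /image_ofP[d ->]; rewrite /act -rmorphD !scE rmorphD mulrDl.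
- by move=> c y z; rewrite /act mulrDr.
- by move=> y; rewrite /act -(rmorph1 phi) scE rmorph1 mul1r.
- by move=> _ y /image_ofP[c ->]; apply: JZ.
- move=> lam /functional_scalar[mu muE [muD muZ]].
  have -> : \sum_(z <- s) act (lam z.1) z.2 = \sum_(z <- s) psi (mu z.1) * z.2.
    by apply: eq_bigr => z _; rewrite /act muE scE.
  by apply: (sJ (psi \o mu)); split=> [x y|c x] /=; rewrite ?muD ?muZ (rmorphD, rmorphM).
exists s' => // M m [mDr mDl mZ]; apply: E; split=> // _ /image_ofP[c ->] x y.
by rewrite /act scE mZ.
Qed.

Definition klinear_map := {f : A -> B | klinear f}.

Definition ev (s : seq (A * B)) (f : A -> B) : B := \sum_(z <- s) f z.1 * z.2.

Lemma ev_cat s t f : ev (s ++ t) f = ev s f + ev t f.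
Proof. by rewrite /ev big_cat. Qed.

Lemma klinear_exists : exists2 f, klinear f & f 1 = 1.
Proof.
have [||||lam [flam lam1 _]] := @exists_functional A image_of image_subfield (eq 0) 1.
- by [].
- by move=> _ _ <- <-; rewrite addr0.
- by move=> c _ _ <-; rewrite mulr0.
- by move/eqP; rewrite eq_sym oner_eq0.
have [mu muE [muD muZ]] := functional_scalar flam.
exists (psi \o mu) => /=.
  by split=> [x y|c x] /=; rewrite ?muD ?muZ (rmorphD, rmorphM).
suff -> : mu 1 = 1 by rewrite rmorph1.
by apply: (fmorph_inj phi); rewrite -muE lam1 rmorph1.
Qed.

Definition ev_mul (s t : seq (A * B)) : seq (A * B) :=
  [seq (x.1 * y.1, x.2 * y.2) | x <- s, y <- t].

Lemma ev_mulE s t f :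
  ev (ev_mul s t) f = ev s (fun x => ev t (fun y => f (x * y))).
Proof.
rewrite /ev /ev_mul big_allpairs_dep; apply: eq_bigr => x _.
rewrite mulr_suml; apply: eq_bigr => y _ /=.
by rewrite mulrA mulrAC.
Qed.

Lemma ev_mulC s t f : ev (ev_mul s t) f = ev (ev_mul t s) f.
Proof.
rewrite /ev /ev_mul !big_allpairs_dep exchange_big /=.
apply: eq_bigr => x _; apply: eq_bigr => y _.
by rewrite mulrC [_.2 * _]mulrC mulrC [_.1 * _]mulrC.
Qed.

Lemma klinear_translate f x : klinear f -> klinear (fun y => f (x * y)).
Proof.
by move=> [fD fZ]; split=> [y z|c y]; rewrite ?mulrDr ?fD // mulrCA fZ.
Qed.

Lemma klinear_ev t f : klinear f -> klinear (fun x => ev t (fun y => f (x * y))).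
Proof.
move=> [fD fZ]; split=> [x y|c x]; rewrite /ev.
  by rewrite -big_split; apply: eq_bigr => z _; rewrite mulrDl fD mulrDl.
by rewrite mulr_sumr; apply: eq_bigr => z _; rewrite -mulrA fZ mulrA.
Qed.

(** The bidual picture of the tensor product: a formal sum of pairs is
    identified with the values that it takes on the linear maps from A to B. *)
Definition tens := {t : klinear_map -> B | exists s, t = fun f => ev s (sval f)}.

HB.instance Definition _ := gen_eqMixin tens.
HB.instance Definition _ := gen_choiceMixin tens.

Definition tens_of (s : seq (A * B)) : tens :=
  exist _ (fun f : klinear_map => ev s (sval f)) (ex_intro _ s erefl).

Lemma tens_ofP s t : tens_of s = tens_of t <-> forall f, klinear f -> ev s f = ev t f.
Proof.
split=> [/(congr1 sval) st f fl|st].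
  by have := congr1 (fun g => g (exist _ f fl)) st.
by apply: eq_exist; apply/funext => -[f fl]; apply: st.
Qed.

Lemma tens_repr (t : tens) : exists s, tens_of s = t.
Proof.
by case: t => t [s tE]; exists s; apply: eq_exist; rewrite tE.
Qed.

Definition tens_rep t := sval (cid (tens_repr t)).

Lemma tens_repK t : tens_of (tens_rep t) = t.
Proof. by rewrite /tens_rep; case: cid. Qed.

Lemma ev_rep s f : klinear f -> ev (tens_rep (tens_of s)) f = ev s f.
Proof. by move=> fl; move: f fl; apply/tens_ofP; rewrite tens_repK. Qed.

Lemma tens_eq t t' : (forall f, klinear f -> ev (tens_rep t) f = ev (tens_rep t') f) -> t = t'.
Proof. by move=> h; rewrite -[t]tens_repK -[t']tens_repK; apply/tens_ofP. Qed.

Definition tens_add t t' := tens_of (tens_rep t ++ tens_rep t').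
Definition tens_opp t := tens_of [seq (z.1, - z.2) | z <- tens_rep t].
Definition tens_mul t t' := tens_of (ev_mul (tens_rep t) (tens_rep t')).

Lemma ev_add t t' f : klinear f ->
  ev (tens_rep (tens_add t t')) f = ev (tens_rep t) f + ev (tens_rep t') f.
Proof. by move=> fl; rewrite ev_rep // ev_cat. Qed.

Lemma ev_opp t f : klinear f -> ev (tens_rep (tens_opp t)) f = - ev (tens_rep t) f.
Proof.
move=> fl; rewrite ev_rep // /ev big_map -sumrN.
by apply: eq_bigr => z _; rewrite mulrN.
Qed.

Lemma ev_tmul t t' f : klinear f ->
  ev (tens_rep (tens_mul t t')) f =
  ev (tens_rep t) (fun x => ev (tens_rep t') (fun y => f (x * y))).
Proof. by move=> fl; rewrite ev_rep // ev_mulE. Qed.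

Lemma ev_nil f : ev [::] f = 0. Proof. exact: big_nil. Qed.

Lemma ev_one x y f : ev [:: (x, y)] f = f x * y. Proof. exact: big_seq1. Qed.

Lemma tens_addA : associative tens_add.
Proof. by move=> x y z; apply: tens_eq => f fl; rewrite !ev_add // addrA. Qed.
Lemma tens_addC : commutative tens_add.
Proof. by move=> x y; apply: tens_eq => f fl; rewrite !ev_add // addrC. Qed.
Lemma tens_add0 : left_id (tens_of [::]) tens_add.
Proof. by move=> x; apply: tens_eq => f fl; rewrite ev_add // ev_rep // ev_nil add0r. Qed.
Lemma tens_addN : left_inverse (tens_of [::]) tens_opp tens_add.
Proof.
by move=> x; apply: tens_eq => f fl; rewrite ev_add // ev_opp // ev_rep // ev_nil addNr.
Qed.

HB.instance Definition _ := GRing.isZmodule.Build tens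
  tens_addA tens_addC tens_add0 tens_addN.

Lemma tens_mulC : commutative tens_mul.
Proof.
by move=> x y; apply: tens_eq => f fl; rewrite !ev_rep // ev_mulC.
Qed.
Lemma tens_mulA : associative tens_mul.
Proof.
move=> x y z; apply: tens_eq => f fl; rewrite !ev_tmul //; last exact: klinear_ev.
apply: eq_bigr => u _; rewrite ev_tmul; last exact: klinear_translate.
congr (_ * _); apply: eq_bigr => v _; congr (_ * _).
by apply: eq_bigr => w _; rewrite mulrA.
Qed.
Lemma tens_mul1 : left_id (tens_of [:: (1, 1)]) tens_mul.
Proof.
move=> x; apply: tens_eq => f fl; rewrite ev_tmul // ev_rep; last exact: klinear_ev.
by rewrite ev_one mulr1; apply: eq_bigr => y _; rewrite mul1r.
Qed.
Lemma tens_mulDl : left_distributive tens_mul tens_add.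
Proof.
move=> x y z; apply: tens_eq => f fl.
by rewrite ev_tmul // !ev_add // ?ev_tmul //; exact: klinear_ev.
Qed.
Lemma tens_oner_neq0 : tens_of [:: (1, 1)] != 0.
Proof.
apply/eqP => /tens_ofP h; have [f fl f1] := klinear_exists.
by have /eqP := h f fl; rewrite ev_one ev_nil f1 mulr1 oner_eq0.
Qed.

HB.instance Definition _ := GRing.Zmodule_isComNzRing.Build tens
  tens_mulA tens_mulC tens_mul1 tens_mulDl tens_oner_neq0.

Definition tens_inl (x : A) : tens := tens_of [:: (x, 1)].
Definition tens_inr (y : B) : tens := tens_of [:: (1, y)].

Lemma tens_of_mul s t : tens_of s * tens_of t = tens_of (ev_mul s t).
Proof.
apply: tens_eq => f fl.
rewrite ev_tmul // ev_rep; last exact: klinear_ev.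
rewrite ev_rep // ev_mulE; apply: eq_bigr => x _.
by rewrite ev_rep //; exact: klinear_translate.
Qed.

Lemma tens_of_cat s t : tens_of (s ++ t) = tens_of s + tens_of t.
Proof. by apply: tens_eq => f fl; rewrite ev_add // !ev_rep // ev_cat. Qed.

Lemma tens_inl_zmod : zmod_morphism tens_inl.
Proof.
move=> x y; apply: tens_eq => f fl.
rewrite ev_add // ev_opp // !ev_rep // !ev_one !mulr1.
by case: fl => fD _; apply: (addIr (f y)); rewrite -fD !subrK.
Qed.
Lemma tens_inr_zmod : zmod_morphism tens_inr.
Proof.
move=> x y; apply: tens_eq => f fl.
by rewrite ev_add // ev_opp // !ev_rep // !ev_one mulrBr.
Qed.
Lemma tens_inl_monoid : monoid_morphism tens_inl.
Proof.
by split=> // x y; rewrite /tens_inl tens_of_mul /ev_mul /= mulr1.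
Qed.
Lemma tens_inr_monoid : monoid_morphism tens_inr.
Proof.
by split=> // x y; rewrite /tens_inr tens_of_mul /ev_mul /= mulr1.
Qed.

HB.instance Definition _ := GRing.isZmodMorphism.Build A tens tens_inl tens_inl_zmod.
HB.instance Definition _ := GRing.isMonoidMorphism.Build A tens tens_inl tens_inl_monoid.
HB.instance Definition _ := GRing.isZmodMorphism.Build B tens tens_inr tens_inr_zmod.
HB.instance Definition _ := GRing.isMonoidMorphism.Build B tens tens_inr tens_inr_monoid.

Lemma tens_ofE s : tens_of s = \sum_(z <- s) tens_inl z.1 * tens_inr z.2.
Proof.
elim: s => [|[x y] s IH]; first by rewrite big_nil.
rewrite big_cons -IH -cat1s tens_of_cat; congr (_ + _).
by rewrite /tens_inl /tens_inr tens_of_mul /ev_mul /= mulr1 mul1r.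
Qed.

(** A formal sum on which all linear maps vanish is a consequence of the
    bilinearity relations, which is the universal property. *)
Lemma tens_well_defined s (M : zmodType) (m : A -> B -> M) : kbalanced m ->
  (forall f, klinear f -> ev s f = 0) -> \sum_(z <- s) m z.1 z.2 = 0.
Proof.
move=> mb s0; have [||||s' sJ <- //] := @coefficients_in_klinear (eq 0) s.
- by [].
- by move=> _ _ <- <-; rewrite subrr.
- by move=> c _ <-; rewrite mulr0.
- by move=> f /s0.
rewrite big_seq big1 // => z zs; rewrite -(sJ z.2) ?map_f //.
by case: mb => mDr _ _; apply: morph_add0.
Qed.

Lemma tens_tensor : tensor_product phi psi tens_inl tens_inr.
Proof.
split=> [c|M m mDr mDl mZ].
  by apply/tens_ofP => f [fD fZ]; rewrite !ev_one -[phi c]mulr1 fZ mulr1 mulrC.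
have mb : kbalanced m by [].
pose g (t : tens) := \sum_(z <- tens_rep t) m z.1 z.2.
have gE s : g (tens_of s) = \sum_(z <- s) m z.1 z.2.
  apply/eqP; rewrite -subr_eq0 -sumrN /g.
  have -> : \sum_(z <- s) - m z.1 z.2 = \sum_(z <- [seq (z.1, - z.2) | z <- s]) m z.1 z.2.
    rewrite big_map; apply: eq_bigr => z _ /=; apply: (addrI (m z.1 z.2)).
    by rewrite -mDr !subrr (morph_add0 (mDr _)).
  rewrite -big_cat; apply/eqP/tens_well_defined => // f fl.
  rewrite ev_cat ev_rep // /ev big_map -big_split big1 //= => z _.
  by rewrite mulrN subrr.
have gD : {morph g : x y / x + y}.
  by move=> x y; rewrite [x + y]/(tens_add x y) gE big_cat.
have gB : zmod_morphism g.
  by move=> x y; apply: (addIr (g y)); rewrite -gD !subrK.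
pose gA : {additive tens -> M} := HB.pack g (GRing.isZmodMorphism.Build _ _ g gB).
exists gA => [x y|g' g'E t] /=.
  by rewrite /tens_inl /tens_inr tens_of_mul gE /ev_mul /= big_seq1 mulr1 mul1r.
rewrite -[t]tens_repK gE tens_ofE raddf_sum; apply: eq_bigr => z _.
exact: g'E.
Qed.

End TensorModel.

(** * Tensor products over a field *)

Section TensorTheory.
Variables (K : fieldType) (A B T : comNzRingType).
Variables (phi : {rmorphism K -> A}) (psi : {rmorphism K -> B}).
Variables (a : {rmorphism A -> T}) (b : {rmorphism B -> T}).
Hypothesis T_tensor : tensor_product phi psi a b.

Lemma tensor_comm c : a (phi c) = b (psi c). Proof. by case: T_tensor. Qed.

Lemma tensor_balanced : kbalanced phi psi (fun x y => a x * b y).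
Proof.
split=> [x y z|y x z|c x y]; rewrite ?rmorphD ?mulrDr ?mulrDl //.
by rewrite !rmorphM tensor_comm mulrCA mulrA.
Qed.

Lemma tensor_lift (M : zmodType) (m : A -> B -> M) : kbalanced phi psi m ->
  exists g : {additive T -> M}, forall x y, g (a x * b y) = m x y.
Proof.
move=> [mDr mDl mZ]; have [_ /(_ M m mDr mDl mZ)[g gE _]] := T_tensor.
by exists g.
Qed.

Lemma tensor_lift_unique (M : zmodType) (g g' : {additive T -> M}) :
  (forall x y, g (a x * b y) = g' (a x * b y)) -> g =1 g'.
Proof.
move=> gg'; have [_ /(_ M (fun x y => g (a x * b y)))[|||h _ hU]] := T_tensor.
- by move=> x y z; rewrite !rmorphD mulrDr raddfD.
- by move=> x y z; rewrite !rmorphD mulrDl raddfD.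
- by move=> c x y; have [_ _ ->] := tensor_balanced.
by move=> t; rewrite (hU g) // (hU g').
Qed.

(** The universal property characterizes the pure tensors as a generating
    family because the explicit model is generated by them. *)
Lemma tensor_span t : exists s : seq (A * B), t = \sum_(z <- s) a z.1 * b z.2.
Proof.
have [mDr mDl mZ] := tensor_balanced.
have [_ /(_ T _ mDr mDl mZ)[g gE _]] := tens_tensor phi psi.
have inb : kbalanced phi psi (fun x y => tens_inl phi psi x * tens_inr phi psi y).
  split=> [x y z|y x z|c x y]; rewrite ?rmorphD ?mulrDr ?mulrDl //.
  by rewrite !rmorphM (tens_tensor phi psi).1 mulrCA mulrA.
have [f fE] := tensor_lift inb.
have -> : t = g (f t).
  apply: (@tensor_lift_unique _ idfun (g \o f)) => x y.
  by rewrite /= fE gE.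
have [s <-] := tens_repr (f t).
by exists s; rewrite tens_ofE raddf_sum; apply: eq_bigr => z _; rewrite gE.
Qed.

Lemma tensor_rmorphism (C : comNzRingType)
    (f : {rmorphism A -> C}) (g : {rmorphism B -> C}) :
  (forall c, f (phi c) = g (psi c)) ->
  exists h : {rmorphism T -> C}, (forall x, h (a x) = f x) /\ (forall y, h (b y) = g y).
Proof.
move=> fg; have [h hE] : exists h : {additive T -> C}, forall x y, h (a x * b y) = f x * g y.
  apply: tensor_lift; split=> [x y z|y x z|c x y].
  - by rewrite rmorphD mulrDr.
  - by rewrite rmorphD mulrDl.
  - by rewrite !rmorphM fg mulrCA mulrA.
have hM : monoid_morphism h.
  split; first by rewrite -[1]mulr1 -{1}(rmorph1 a) -{1}(rmorph1 b) hE !rmorph1 mulr1.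
  move=> t u; have [s ->] := tensor_span t; have [r ->] := tensor_span u.
  rewrite mulr_suml !raddf_sum mulr_suml; apply: eq_bigr => x _.
  rewrite !mulr_sumr raddf_sum; apply: eq_bigr => y _.
  by rewrite mulrACA -!rmorphM !hE !rmorphM mulrACA.
pose h' : {rmorphism T -> C} := HB.pack (GRing.Additive.sort h)
  (GRing.isMonoidMorphism.Build _ _ h hM).
exists h'; split=> z; rewrite -[h' _]/(h _).
  by rewrite -[a z]mulr1 -(rmorph1 b) hE rmorph1 mulr1.
by rewrite -[b z]mul1r -(rmorph1 a) hE rmorph1 mul1r.
Qed.

Lemma tensor_sym : tensor_product psi phi b a.
Proof.
split=> [c|M m mDr mDl mZ]; first by rewrite tensor_comm.
have [g gE] : exists g : {additive T -> M}, forall x y, g (a x * b y) = m y x.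
  by apply: tensor_lift; split.
exists g => [x y|g' g'E]; first by rewrite mulrC gE.
by apply: tensor_lift_unique => x y; rewrite gE mulrC g'E.
Qed.

(** The B-linear map T -> B obtained from a linear map A -> B. *)
Lemma tensor_contract f : klinear phi psi f ->
  exists2 g : {additive T -> B}, forall x y, g (a x * b y) = f x * y
    & forall y t, g (b y * t) = y * g t.
Proof.
move=> [fD fZ]; have [g gE] : exists g : {additive T -> B}, forall x y, g (a x * b y) = f x * y.
  apply: tensor_lift; split=> [x y z|y x z|c x y].
  - by rewrite mulrDr.
  - by rewrite fD mulrDl.
  - by rewrite fZ mulrAC mulrA mulrC mulrA.
exists g => // y t; have [s ->] := tensor_span t.
rewrite mulr_sumr !raddf_sum mulr_sumr; apply: eq_bigr => z _.
by rewrite mulrCA -rmorphM !gE mulrCA.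
Qed.

(** Flatness of T over B, in the form used throughout: an element all of
    whose contractions lie in J comes from the tensor product with J. *)
Lemma tensor_detect (J : B -> Prop) t :
    J 0 -> (forall y z, J y -> J z -> J (y - z)) ->
    (forall c y, J y -> J (psi c * y)) ->
    (forall f (g : {additive T -> B}), klinear phi psi f ->
       (forall x y, g (a x * b y) = f x * y) -> J (g t)) ->
  exists2 s : seq (A * B), forall z, z \in map snd s -> J z
    & t = \sum_(z <- s) a z.1 * b z.2.
Proof.
move=> J0 JB JZ tJ; have [s tE] := tensor_span t.
have [||||s' sJ' E] := @coefficients_in_klinear _ _ _ phi psi J s => //.
  move=> f fl; have [g gE _] := tensor_contract fl.
  have := tJ f g fl gE; rewrite tE raddf_sum.
  by under eq_bigr do rewrite gE.
by exists s' => //; rewrite tE (E _ _ tensor_balanced).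
Qed.

Lemma tensor_eq0 t :
  (forall f (g : {additive T -> B}), klinear phi psi f ->
     (forall x y, g (a x * b y) = f x * y) -> g t = 0) -> t = 0.
Proof.
move=> t0; have [||||s sJ ->] := @tensor_detect (eq 0) t.
- by [].
- by move=> _ _ <- <-; rewrite subrr.
- by move=> c _ <-; rewrite mulr0.
- by move=> f g fl gE; rewrite (t0 f g).
by rewrite big_seq big1 // => z zs; rewrite -(sJ z.2) ?map_f // rmorph0 mulr0.
Qed.

End TensorTheory.

Lemma tensor_exists (K : fieldType) (A B : comNzRingType)
    (phi : {rmorphism K -> A}) (psi : {rmorphism K -> B}) :
  exists (T : comNzRingType) (a : {rmorphism A -> T}) (b : {rmorphism B -> T}),
    tensor_product phi psi a b.
Proof.
by exists (tens phi psi), (tens_inl phi psi), (tens_inr phi psi); exact: tens_tensor.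
Qed.

(** (A (x)_K M) (x)_M N = A (x)_K N. *)
Lemma tensor_base_change (K M : fieldType) (A N T T0 : comNzRingType)
    (phi : {rmorphism K -> A}) (psi : {rmorphism K -> M}) (chi : {rmorphism M -> N})
    (a : {rmorphism A -> T}) (b : {rmorphism M -> T})
    (a0 : {rmorphism A -> T0}) (b0 : {rmorphism N -> T0}) (tau : {rmorphism T -> T0}) :
    tensor_product phi psi a b -> tensor_product phi (chi \o psi) a0 b0 ->
    (forall x, tau (a x) = a0 x) -> (forall y, tau (b y) = b0 (chi y)) ->
  tensor_product b chi tau b0.
Proof.
move=> Tt T0t taua taub; split=> // P m mDr mDl mZ.
have [g gE] : exists g : {additive T0 -> P}, forall x y, g (a0 x * b0 y) = m (a x) y.
  apply: (tensor_lift T0t); split=> [x y z|y x z|c x y] /=.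
  - exact: mDr.
  - by rewrite rmorphD; exact: mDl.
  - by rewrite rmorphM (tensor_comm Tt) mZ.
exists g => [t y|g' g'E].
  have [s ->] := tensor_span Tt t.
  rewrite raddf_sum mulr_suml raddf_sum.
  rewrite (morph_add_sum _ _ (mDl y)); apply: eq_bigr => z _ /=.
  by rewrite rmorphM taua taub -mulrA -rmorphM gE -mZ mulrC.
apply: (tensor_lift_unique T0t) => x y; rewrite gE -taua; exact: g'E.
Qed.

(** Exactness: only the right factors can be responsible for the vanishing of
    a tensor after a change of the right-hand ring. *)
Lemma tensor_kernel (K : fieldType) (A B B' T T' : comNzRingType)
    (phi : {rmorphism K -> A}) (psi : {rmorphism K -> B}) (psi' : {rmorphism K -> B'})
    (a : {rmorphism A -> T}) (b : {rmorphism B -> T})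
    (a' : {rmorphism A -> T'}) (b' : {rmorphism B' -> T'})
    (u : {rmorphism B -> B'}) (pi : {rmorphism T -> T'}) (t : T) :
    tensor_product phi psi a b -> tensor_product phi psi' a' b' ->
    (forall c, psi' c = u (psi c)) ->
    (forall x, pi (a x) = a' x) -> (forall y, pi (b y) = b' (u y)) -> pi t = 0 ->
  exists2 s : seq (A * B), forall y, y \in map snd s -> u y = 0
    & t = \sum_(z <- s) a z.1 * b z.2.
Proof.
move=> Tt T't psiE pia pib t0; apply: (tensor_detect Tt).
- exact: rmorph0.
- by move=> x y hx hy; rewrite rmorphB hx hy subrr.
- by move=> c x hx; rewrite rmorphM hx mulr0.
move=> f g [fD fZ] gE.
have [|eps epsE _] := @tensor_contract _ _ _ _ _ _ _ _ T't (u \o f).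
  split=> [x y|c x] /=; first by rewrite fD rmorphD.
  by rewrite fZ rmorphM psiE.
rewrite -[LHS]/((u \o g) t) (@tensor_lift_unique _ _ _ _ _ _ _ _ Tt _ _ (eps \o pi)).
  by rewrite /= t0 raddf0.
by move=> x y /=; rewrite gE !rmorphM pia pib epsE.
Qed.

(** * Localizations of tensor products and separability *)

(** E is the local ring of T at the kernel of h. *)
Definition localizes (T : comNzRingType) (E : fieldType) (h : {rmorphism T -> E}) : Prop :=
  (forall y, exists x s, h s != 0 /\ y = h x / h s) /\
  (forall x, h x = 0 -> exists2 s, h s != 0 & s * x = 0).

Lemma localizes_strictly_maximal (T : comNzRingType) (E : fieldType)
  (h : {rmorphism T -> E}) : localizes h -> strictly_maximal (ker_point h).
Proof.
move=> [hfrac hker]; exists E, h; split.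
- by move=> s; rewrite inE unitfE.
- by move=> y; have [x [s [hs ->]]] := hfrac y; exists x, s; rewrite inE.
- move=> x y hxy; have [|s hs sxy] := hker (x - y).
    by rewrite rmorphB hxy subrr.
  by exists s; [rewrite inE|apply/eqP; rewrite -subr_eq0 -mulrBr sxy].
Qed.

Lemma localizes_seq (T : comNzRingType) (E : fieldType) (h : {rmorphism T -> E})
    (xs : seq T) : localizes h -> (forall x, x \in xs -> h x = 0) ->
  exists2 s, h s != 0 & forall x, x \in xs -> s * x = 0.
Proof.
move=> [_ hker]; elim: xs => [|x xs IH] xs0.
  by exists 1; rewrite ?rmorph1 ?oner_eq0.
have [|s hs sxs] := IH; first by move=> y yxs; apply: xs0; rewrite inE yxs orbT.
have [|r hr rx] := hker x; first by apply: xs0; rewrite mem_head.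
exists (s * r); first by rewrite rmorphM mulf_neq0.
move=> y; rewrite inE => /predU1P[->|/sxs sy]; first by rewrite -mulrA rx mulr0.
by rewrite mulrAC sy mul0r.
Qed.

(** For an extension N of M, the ring E (x)_M N is the localization of
    T (x)_M N = L (x)_K N at the elements of T outside the kernel of h, and a
    localization of a reduced ring is reduced. *)
Lemma separable_localizes (K L M E : fieldType) (T : comNzRingType)
    (phi : {rmorphism K -> L}) (psi : {rmorphism K -> M})
    (a : {rmorphism L -> T}) (b : {rmorphism M -> T}) (h : {rmorphism T -> E})
    (hb : {rmorphism M -> E}) :
    tensor_product phi psi a b -> localizes h -> hb =1 h \o b ->
  separable_ext phi -> separable_ext hb.
Proof.
move=> Tt hloc hbE sep_phi N chi.
have [T0 [a0 [b0 [T0t T0red]]]] := sep_phi N (chi \o psi).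
have [tau [taua taub]] := tensor_rmorphism Tt (f := a0) (g := b0 \o chi) (tensor_comm T0t).
have T0M := tensor_base_change Tt T0t taua taub.
have [T1 [alpha [beta T1t]]] := tensor_exists hb chi.
have [|theta [thetaT thetaN]] := tensor_rmorphism T0M (f := alpha \o h) (g := beta).
  by move=> c /=; rewrite -[h _]/((h \o b) c) -hbE (tensor_comm T1t).
exists T1, alpha, beta; split=> //.
have theta_ker t : theta t = 0 -> exists2 s, h s != 0 & tau s * t = 0.
  move=> t0; have [s sJ tE] : exists2 s : seq (N * T),
      forall y, y \in map snd s -> h y = 0 & t = \sum_(z <- s) b0 z.1 * tau z.2.
    apply: (tensor_kernel (tensor_sym T0M) (tensor_sym T1t) (u := h) _ thetaN thetaT t0).
    exact: hbE.
  have [x|r hr rs] := @localizes_seq _ _ _ (map snd s) hloc; first exact: sJ.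
  exists r => //; rewrite tE mulr_sumr big_seq big1 // => z zs.
  by rewrite mulrCA -rmorphM rs ?map_f // rmorph0 mulr0.
have theta_frac t : exists s t0, h s != 0 /\ alpha (h s) * t = theta t0.
  have [s ->] := tensor_span T1t t; elim: s => [|[y n] s [r [t0 [hr rE]]]].
    exists 1, 0; rewrite big_nil mulr0 !rmorph0 rmorph1 oner_eq0; by [].
  have [x [r' [hr' ->]]] := hloc.1 y.
  exists (r * r'), (tau (r * x) * b0 n + tau r' * t0); split.
    by rewrite rmorphM mulf_neq0.
  rewrite big_cons mulrDr rmorphD; congr (_ + _).
    rewrite [RHS]rmorphM thetaT thetaN mulrA -(rmorphM alpha) /=; congr (alpha _ * _).
    by rewrite !rmorphM -mulrA; congr (_ * _); rewrite mulrC divfK.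
  by rewrite [r * r']mulrC [RHS]rmorphM thetaT /= -rE !rmorphM mulrA.
move=> t n tn; have [s [t0 [hs st]]] := theta_frac t.
have [|r hr rt] := theta_ker (t0 ^+ n).
  by rewrite rmorphXn -st exprMn tn mulr0.
have rt0 : tau r * t0 = 0.
  apply: (T0red _ n.+1); rewrite exprMn [t0 ^+ _]exprSr [tau r ^+ _]exprS.
  by rewrite mulrACA rt mul0r.
have := congr1 theta rt0; rewrite rmorph0 rmorphM -st thetaT /= mulrA -!rmorphM => h0.
have rs0 : h (r * s) != 0 by rewrite rmorphM mulf_neq0.
by rewrite -[t]mul1r -(rmorph1 alpha) -(mulVf rs0) (rmorphM alpha) -mulrA h0 mulr0.
Qed.

(** * Fraction fields *)

Lemma fraction_extension (R : comNzRingType) (K L : fieldType)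
    (i : {rmorphism R -> K}) (h : {rmorphism R -> L}) :
    (forall y, exists x s, i s != 0 /\ y = i x / i s) ->
    (forall x, (i x == 0) = (h x == 0)) ->
  exists g : {rmorphism K -> L}, forall x, g (i x) = h x.
Proof.
move=> frac ker.
have /choice[nd ndP] : forall y, exists xs : R * R, i xs.2 != 0 /\ y = i xs.1 / i xs.2.
  by move=> y; have [x [s xs]] := frac y; exists (x, s).
pose g y := h (nd y).1 / h (nd y).2.
have gE x s : i s != 0 -> g (i x / i s) = h x / h s.
  move=> is0; have [id0 E] := ndP (i x / i s); move: id0 E; rewrite /g.
  move: (nd _).1 (nd _).2 => y t it0 /eqP; rewrite eqr_div // -!rmorphM -subr_eq0 -rmorphB ker.
  by rewrite rmorphB !rmorphM subr_eq0 -eqr_div -?ker // => /eqP.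
have g_zmod : zmod_morphism g.
  move=> y z; have [x [s [s0 ->]]] := frac y; have [x' [s' [s'0 ->]]] := frac z.
  rewrite -mulNr addf_div // -!rmorphN -!rmorphM -rmorphD !gE //; last by rewrite rmorphM mulf_neq0.
  by rewrite -mulNr addf_div -?ker // rmorphD !rmorphM rmorphN.
have g_monoid : monoid_morphism g.
  split=> [|y z].
    by rewrite -[1](divr1 1) -(rmorph1 i) gE ?rmorph1 ?oner_eq0 // divr1.
  have [x [s [s0 ->]]] := frac y; have [x' [s' [s'0 ->]]] := frac z.
  rewrite mulf_div -!rmorphM !gE //; last by rewrite rmorphM mulf_neq0.
  by rewrite !rmorphM mulf_div.
pose gR : {rmorphism K -> L} := HB.pack g (GRing.isZmodMorphism.Build _ _ g g_zmod)
  (GRing.isMonoidMorphism.Build _ _ g g_monoid).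
exists gR => x; rewrite -[gR _]/(g _) -[i x]divr1 -(rmorph1 i) gE ?rmorph1 ?oner_eq0 //.
by rewrite divr1.
Qed.

(** The residue field of R at the kernel of a morphism to a field E is the
    subfield of E that consists of the fractions of elements of the image. *)
Section FractionSubfield.
Variables (R : comNzRingType) (E : fieldType) (h : {rmorphism R -> E}).

Definition fractions : {pred E} :=
  [pred y | `[< exists x s, h s != 0 /\ y = h x / h s >]].

Lemma fractions_divring : divring_closed fractions.
Proof.
split.
- by apply/asboolP; exists 1, 1; rewrite rmorph1 oner_eq0 divr1.
- move=> _ _ /asboolP[x [s [s0 ->]]] /asboolP[y [t [t0 ->]]]; apply/asboolP.
  exists (x * t - y * s), (s * t); split; first by rewrite rmorphM mulf_neq0.
  by rewrite -mulNr addf_div // rmorphB !rmorphM mulNr.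
- move=> _ _ /asboolP[x [s [s0 ->]]] /asboolP[y [t [t0 ->]]]; apply/asboolP.
  have [y0|y0] := eqVneq (h y) 0.
    by exists 0, 1; rewrite y0 mul0r invr0 mulr0 rmorph0 mul0r rmorph1 oner_eq0.
  exists (x * t), (s * y); split; first by rewrite rmorphM mulf_neq0.
  by rewrite invf_div mulf_div !rmorphM.
Qed.

HB.instance Definition _ := GRing.isDivringClosed.Build E fractions fractions_divring.

Record fraction_sub := FractionSub { fraction_val : E; _ : fraction_val \in fractions }.

HB.instance Definition _ := [isSub for fraction_val].
HB.instance Definition _ := [Choice of fraction_sub by <:].
HB.instance Definition _ := [SubChoice_isSubIntegralDomain of fraction_sub by <:].
HB.instance Definition _ := [SubIntegralDomain_isSubField of fraction_sub by <:].

Lemma mem_fractions x : h x \in fractions.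
Proof. by apply/asboolP; exists x, 1; rewrite rmorph1 divr1 oner_eq0. Qed.

Definition to_fraction (x : R) : fraction_sub := FractionSub (mem_fractions x).

Lemma to_fraction_zmod : zmod_morphism to_fraction.
Proof. by move=> x y; apply: val_inj; rewrite /= !rmorphB. Qed.
Lemma to_fraction_monoid : monoid_morphism to_fraction.
Proof. by split=> [|x y]; apply: val_inj; rewrite ?(rmorph1, rmorphM) //= (rmorph1, rmorphM). Qed.

HB.instance Definition _ := GRing.isZmodMorphism.Build R fraction_sub to_fraction to_fraction_zmod.
HB.instance Definition _ := GRing.isMonoidMorphism.Build R fraction_sub to_fraction to_fraction_monoid.

End FractionSubfield.

Lemma residue_field_exists (R : comNzRingType) (E : fieldType) (h : {rmorphism R -> E}) :
  exists (K : fieldType) (c : {rmorphism R -> K}), residue_field_at (ker_point h) c.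
Proof.
exists (fraction_sub h), (to_fraction h); split.
  by apply: spec_eqP => x; rewrite !inE -(inj_eq val_inj).
move=> [y hy]; have /asboolP[x [s [s0 yE]]] := hy; exists x, s.
split; first by rewrite -(inj_eq val_inj).
by apply: val_inj; rewrite rmorphM fmorphV /=.
Qed.

(** * Linear systems over a valuation ring *)

Lemma least_element (T : eqType) (P : T -> Prop) (D : T -> T -> Prop) (s : seq T) :
    (forall x, P x -> D x x) -> (forall x y z, D x y -> D y z -> D x z) ->
    (forall x y, P x -> P y -> D x y \/ D y x) ->
    s != [::] -> (forall x, x \in s -> P x) ->
  exists2 x, x \in s & forall y, y \in s -> D x y.
Proof.
move=> Drefl Dtrans Dtotal; elim: s => // x s IH _ sP.
have Px : P x by apply: sP; rewrite mem_head.
have [->|s0] := eqVneq s [::].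
  by exists x => [|y]; rewrite inE // => /eqP->; exact: Drefl.
have [|y ys yP] := IH s0; first by move=> y ys; apply: sP; rewrite inE ys orbT.
have Py : P y by apply: sP; rewrite inE ys orbT.
have [xy|yx] := Dtotal x y Px Py.
  exists x; first exact: mem_head.
  by move=> t; rewrite inE => /predU1P[->|/yP]; [exact: Drefl|exact: Dtrans].
exists y; first by rewrite inE ys orbT.
by move=> t; rewrite inE => /predU1P[->|/yP].
Qed.

Section LargestDivisor.
Variables (W : comUnitRingType) (U : subringClosed W).
Hypothesis U_inv : {in U, forall x, x \is a GRing.unit -> x^-1 \in U}.
Hypothesis U_total : {in U &, forall x y,
  (exists2 c, c \in U & x = c * y) \/ (exists2 c, c \in U & y = c * x)}.
Hypothesis W_local : forall x y : W,
  x + y \is a GRing.unit -> x \is a GRing.unit \/ y \is a GRing.unit.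

(** Some U-combination of the vectors (e i, M i), with a unit as its first
    coordinate, has all its other coordinates divisible by g. *)
Definition divides_combination m n (e : 'I_m -> W) (M : 'I_m -> 'I_n -> W) (g : W) : Prop :=
  exists2 c : 'I_m -> W, forall i, c i \in U &
    \sum_i c i * e i \is a GRing.unit /\
    forall j, exists2 t, t \in U & \sum_i c i * M i j = g * t.

(** Elimination: the least entry of the matrix clears its column, which leaves
    either a smaller system or that entry as the largest divisor. *)
Lemma largest_divisor m n (e : 'I_m -> W) (M : 'I_m -> 'I_n.+1 -> W) :
    (forall i j, M i j \in U) -> (exists g, divides_combination e M g) ->
  exists2 g, g \in U & divides_combination e M g /\
    forall g', divides_combination e M g' -> exists2 t, t \in U & g = g' * t.
Proof.
elim: m e M => [|m IH] e M MU [g0 Dg0].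
  by case: Dg0 => c _ []; rewrite big_ord0 unitr0.
have [|||||x /allpairsP[[i0 j0] /= [_ _ ->]] aP] := @least_element W (fun x => x \in U)
    (fun x y => exists2 c, c \in U & y = c * x)
    [seq M i j | i <- enum 'I_m.+1, j <- enum 'I_n.+1].
- by move=> x _; exists 1; rewrite ?mul1r ?rpred1.
- by move=> x y z [c cU ->] [d dU ->]; exists (d * c); rewrite ?rpredM ?mulrA.
- by move=> x y xU yU; have [] := U_total xU yU; [right|left].
- by rewrite -size_eq0 size_allpairs !size_enum_ord.
- by move=> _ /allpairsP[[i j] /= [_ _ ->]].
set a := M i0 j0 in aP.
have {aP}aP i j : exists c, c \in U /\ M i j = c * a.
  have [|c cU cE] := aP (M i j); last by exists c.
  by apply/allpairsP; exists (i, j); rewrite !mem_enum.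
have /choice[q qP] : forall ij : 'I_m.+1 * 'I_n.+1, exists c, c \in U /\ M ij.1 ij.2 = c * a.
  by case=> i j; apply: aP.
have qU i j : q (i, j) \in U by have [] := qP (i, j).
have MqE i j : M i j = q (i, j) * a by have [_] := qP (i, j).
pose r i := q (lift i0 i, j0).
pose e' i := e (lift i0 i) - r i * e i0.
pose M' i j := M (lift i0 i) j - r i * M i0 j.
have M'U i j : M' i j \in U by rewrite rpredB ?rpredM ?MU ?qU.
have rearr (c : 'I_m.+1 -> W) (F : 'I_m.+1 -> W) :
    \sum_i c i * F i = \sum_i c (lift i0 i) * (F (lift i0 i) - r i * F i0)
                       + (c i0 + \sum_i c (lift i0 i) * r i) * F i0.
  rewrite (bigD1_ord i0) //= mulrDl mulr_suml [RHS]addrCA -big_split /=; congr (_ + _).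
  by apply: eq_bigr => i _; rewrite mulrBr mulrA subrK.
have M'j0 i : M' i j0 = 0.
  by rewrite /M' MqE subrr.
(* d, the total multiple of row i0, is all that remains in column j0. *)
have from g : divides_combination e M g ->
    divides_combination e' M' g \/ e i0 \is a GRing.unit /\ exists2 t, t \in U & a = g * t.
  move=> [c cU [ce cM]]; pose d := c i0 + \sum_i c (lift i0 i) * r i.
  have dU : d \in U by rewrite rpredD // rpred_sum // => i _; rewrite rpredM ?qU.
  have [t tU daE] : exists2 t, t \in U & d * a = g * t.
    have [t tU tE] := cM j0; exists t; rewrite // -tE rearr.
    by rewrite big1 ?add0r // => i _; rewrite -/(M' i j0) M'j0 mulr0.
  move: ce; rewrite rearr => /W_local[ce|de]; [left|right].
    exists (fun i => c (lift i0 i)) => //; split=> // j.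
    have [t' t'U t'E] := cM j; exists (t' - q (i0, j) * t); first by rewrite rpredB ?rpredM ?qU.
    rewrite mulrBr -t'E rearr mulrCA -daE [X in _ + X - _](_ : _ = q (i0, j) * (d * a)) ?addrK //.
    by rewrite MqE mulrCA.
  move: de; rewrite unitrM => /andP[du ei0]; split=> //; exists (t * d^-1); first by rewrite rpredM ?U_inv.
  by rewrite mulrA -daE mulrAC divrr ?mul1r.
have to g : divides_combination e' M' g -> divides_combination e M g.
  move=> [c cU [ce cM]].
  pose s := - \sum_i c i * r i.
  pose c' i := if unlift i0 i is Some i' then c i' else s.
  have c'l i : c' (lift i0 i) = c i by rewrite /c' liftK.
  have c'0 : c' i0 = s by rewrite /c' unlift_none.
  have E F : \sum_i c' i * F i = \sum_i c i * (F (lift i0 i) - r i * F i0).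
    rewrite rearr c'0 /s; under eq_bigr do rewrite c'l.
    by under [X in (_ + X) * _]eq_bigr do rewrite c'l; rewrite addNr mul0r addr0.
  exists c' => [i|].
    rewrite /c'; case: (unlift i0 i) => [i'|]; first exact: cU.
    by rewrite rpredN rpred_sum // => i' _; rewrite rpredM ?qU.
  split=> [|j]; rewrite E; [exact: ce|exact: cM].
have [[g1 Dg1]|nD] := pselect (exists g, divides_combination e' M' g).
  have [g gU [Dg gmax]] := IH e' M' M'U (ex_intro _ g1 Dg1).
  exists g => //; split; first exact: to.
  have [t tU gE] : exists2 t, t \in U & g = a * t.
    apply: gmax; case: Dg1 => c cU [ce _]; exists c => //; split=> // j.
    exists (\sum_i c i * (q (lift i0 i, j) - r i * q (i0, j))).
      by rewrite rpred_sum // => i _; rewrite rpredM ?rpredB ?rpredM ?qU.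
    rewrite mulr_sumr; apply: eq_bigr => i _; rewrite /M' !MqE mulrA -mulrBl.
    by rewrite [RHS]mulrCA [a * _]mulrC.
  move=> g' /from[/gmax//|[_ [t' t'U aE]]].
  by exists (t' * t); rewrite ?rpredM // mulrA -aE.
exists a; [exact: MU|split]; last first.
  by move=> g' /from[Dg'|[_]//]; case: nD; exists g'.
have [Dg'|[ei0 _]] := from _ Dg0; first by case: nD; exists g0.
exists (fun i => (i == i0)%:R) => [i|]; first by case: eqP; rewrite ?rpred0 ?rpred1.
have E F : \sum_i (i == i0)%:R * F i = F i0 :> W.
  rewrite (bigD1 i0) //= eqxx mul1r big1 ?addr0 // => i /negPf->.
  by rewrite mul0r.
by rewrite E; split=> // j; rewrite E; exists (q (i0, j)); rewrite ?qU // mulrC MqE.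
Qed.

End LargestDivisor.

(** * Every element of W is an element of V times a unit *)

(** The residue field of W enters through eps, whose kernel is the prime at
    which W localizes; eps_strict says that the maximal ideal of V generates
    that of W. *)
Section Localization.
Variables (k k' kx : fieldType) (V W : comUnitRingType) (V' : comNzRingType).
Variables (i : {rmorphism k -> V}) (phi : {rmorphism k -> k'}).
Variables (a : {rmorphism k' -> V'}) (b : {rmorphism V -> V'}).
Variables (l : {rmorphism V' -> W}) (eps : {rmorphism V' -> kx}).
Hypothesis V'_tensor : tensor_product phi i a b.
Hypothesis V_total : forall x y : V, (exists c, x = c * y) \/ (exists c, y = c * x).
Hypothesis V_domain : forall x y : V, x * y = 0 -> x = 0 \/ y = 0.
Hypothesis W_loc : localization_at (ker_point eps) l.
Hypothesis eps_b : forall v, (eps (b v) == 0) = (v \isn't a GRing.unit).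
Hypothesis eps_strict : forall y, eps y = 0 ->
  exists s c z, [/\ eps s != 0, c \isn't a GRing.unit & s * y = b c * z].

Lemma loc_unit s : eps s != 0 -> l s \is a GRing.unit.
Proof. by move=> s0; have [+ _ _] := W_loc; apply; rewrite inE. Qed.

Lemma eps_a x : (eps (a x) == 0) = (x == 0).
Proof. exact: (fmorph_eq0 (eps \o a)). Qed.

Lemma loc_frac y : exists x s, eps s != 0 /\ y = l x / l s.
Proof.
by have [_ /(_ y)[x [s [s0 ->]]] _] := W_loc; exists x, s; rewrite inE in s0.
Qed.

Lemma loc_eq x y : l x = l y -> exists2 s, eps s != 0 & s * x = s * y.
Proof.
by move=> xy; have [_ _ /(_ x y xy)[s s0 sxy]] := W_loc; exists s; rewrite // inE in s0.
Qed.

Lemma loc_unitE (x : V') : (l x \is a GRing.unit) = (eps x != 0).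
Proof.
apply/idP/idP; last exact: loc_unit.
move=> lx; have [y [s [s0 E]]] := loc_frac (l x)^-1.
have ls := loc_unit s0.
have [|t t0 tE] := @loc_eq (x * y) s.
  by rewrite rmorphM -[l y](divrK ls) -E mulrA divrr ?mul1r.
apply: contra_neq t0 => x0; have := congr1 eps tE.
by rewrite !rmorphM x0 mul0r mulr0 => /esym/eqP; rewrite mulf_eq0 (negPf s0) orbF => /eqP.
Qed.

Lemma loc_local (x y : W) : x + y \is a GRing.unit ->
  x \is a GRing.unit \/ y \is a GRing.unit.
Proof.
have [x1 [s [s0 ->]]] := loc_frac x; have [y1 [t [t0 ->]]] := loc_frac y.
have [ls lt] := (loc_unit s0, loc_unit t0).
have -> : l x1 / l s + l y1 / l t = l (x1 * t + y1 * s) / l (s * t).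
  rewrite !rmorphD !rmorphM invrM // mulrDl; congr (_ + _).
    by rewrite mulrA mulrK.
  by rewrite [_^-1 * _]mulrC mulrA mulrK.
rewrite !unitrM !unitrV ls lt !andbT !loc_unitE !rmorphD !rmorphM mulf_neq0 // andbT.
have [->|] := eqVneq (eps x1) 0; last by left.
have [->|] := eqVneq (eps y1) 0; last by right.
by rewrite !mul0r addr0 eqxx.
Qed.

Lemma beta_unit (v : V) : (l (b v) \is a GRing.unit) = (v \is a GRing.unit).
Proof. by rewrite loc_unitE eps_b negbK. Qed.

(** V' is torsion-free over V, by contraction to V. *)
Lemma b_regular v t : v != 0 -> b v * t = 0 -> t = 0.
Proof.
move=> v0 vt; apply: (tensor_eq0 V'_tensor) => f g fl gE.
have [g' g'E g'b] := tensor_contract V'_tensor fl.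
have gg' : g =1 g'.
  by apply: (tensor_lift_unique V'_tensor) => x y; rewrite gE g'E.
have := g'b v t; rewrite vt raddf0 => /esym/V_domain[/eqP|].
  by rewrite (negPf v0).
by rewrite gg'.
Qed.

Lemma beta_regular v y : v != 0 -> l (b v) * y = 0 -> y = 0.
Proof.
move=> v0; have [x [s [s0 ->]]] := loc_frac y; have ls := loc_unit s0.
rewrite mulrA -rmorphM => /(congr1 ( *%R^~ (l s))); rewrite divrK // mul0r => E.
have [|t t0] := @loc_eq (b v * x) 0; first by rewrite rmorph0.
rewrite mulr0 mulrCA => /(b_regular v0) tx.
have -> : l x = 0.
  by apply: (mulrI (loc_unit t0)); rewrite -rmorphM tx rmorph0 mulr0.
by rewrite mul0r.
Qed.

Lemma nonunit_beta (y : W) : y \isn't a GRing.unit ->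
  exists c z, c \isn't a GRing.unit /\ y = l (b c) * z.
Proof.
have [x [s [s0 ->]]] := loc_frac y; have ls := loc_unit s0.
rewrite unitrM unitrV ls andbT loc_unitE negbK => /eqP/eps_strict[t [c [z [t0 cu E]]]].
have lt := loc_unit t0.
exists c, (l z / l t / l s); split=> //.
by rewrite !mulrA -rmorphM -E rmorphM [l t * _]mulrC mulrK.
Qed.

Section Subfield.
Variable S : divringClosed k'.
Hypothesis phi_S : forall c, phi c \in S.

Lemma S_subfield : subfield_in S.
Proof.
split=> [|x y|x y|x xS x0]; rewrite ?rpred1 //; [exact: rpredB|exact: rpredM|].
by exists x^-1; rewrite ?divff // rpredV.
Qed.

(** The image of S (x) V in V'. *)
Definition subtensor : {pred V'} := [pred x | `[< exists2 s : seq (k' * V),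
  (forall z, z \in s -> z.1 \in S) & x = \sum_(z <- s) a z.1 * b z.2 >]].

Lemma subtensor_pure x v : x \in S -> a x * b v \in subtensor.
Proof.
move=> xS; apply/asboolP; exists [:: (x, v)]; last by rewrite big_seq1.
by move=> z; rewrite inE => /eqP->.
Qed.

Lemma subtensor_ind (P : V' -> Prop) : P 0 ->
    (forall x v t, x \in S -> P t -> P (a x * b v + t)) ->
  forall t, t \in subtensor -> P t.
Proof.
move=> P0 PD t /asboolP[s sS ->]; elim: s sS => [|z s IH] sS.
  by rewrite big_nil.
rewrite big_cons; apply: PD; first by apply: sS; rewrite mem_head.
by apply: IH => x xs; apply: sS; rewrite inE xs orbT.
Qed.

Lemma subtensor_subring : subring_closed subtensor.
Proof.
have D x y : x \in subtensor -> y \in subtensor -> x + y \in subtensor.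
  move=> /asboolP[s sS ->] /asboolP[t tS ->]; apply/asboolP; exists (s ++ t).
    by move=> z; rewrite mem_cat => /orP[/sS|/tS].
  by rewrite big_cat.
have Z0 : 0 \in subtensor by apply/asboolP; exists [::]; rewrite ?big_nil.
split.
- by rewrite -[1]mulr1 -{1}(rmorph1 a) -(rmorph1 b) subtensor_pure ?rpred1.
- move=> x y xS yS; apply: (D) => //; elim/subtensor_ind: yS => [|c v t cS tS].
    by rewrite oppr0.
  by rewrite opprD -mulNr -rmorphN; apply: (D) => //; apply: subtensor_pure; rewrite rpredN.
- move=> x y xS yS; elim/subtensor_ind: xS => [|c v t cS tS]; first by rewrite mul0r.
  rewrite mulrDl; apply: (D) => //; elim/subtensor_ind: yS {tS} => [|d w u dS uS].
    by rewrite mulr0.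
  rewrite mulrDr; apply: (D) => //; rewrite mulrACA -!rmorphM.
  by apply: subtensor_pure; rewrite rpredM.
Qed.

HB.instance Definition _ := GRing.isSubringClosed.Build V' subtensor subtensor_subring.

Lemma subtensor_a x : x \in S -> a x \in subtensor.
Proof. by move=> xS; rewrite -[a x]mulr1 -(rmorph1 b) subtensor_pure. Qed.

Lemma subtensor_b v : b v \in subtensor.
Proof. by rewrite -[b v]mul1r -(rmorph1 a) subtensor_pure ?rpred1. Qed.

(** The maps lam (x) id for a functional lam: they are linear over S (x) V. *)
Definition projector (g : V' -> V') : Prop :=
  (forall r t, r \in subtensor -> g (r * t) = r * g t) /\
  (forall t, g t \in subtensor).

Lemma functional_projector lam : functional S lam ->
  exists2 g : {additive V' -> V'}, projector g & forall x v, g (a x * b v) = a (lam x) * b v.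
Proof.
move=> [lamD lamZ lamS].
have [g gE] : exists g : {additive V' -> V'}, forall x v, g (a x * b v) = a (lam x) * b v.
  apply: (tensor_lift V'_tensor); split=> [x y z|y x z|c x y].
  - by rewrite rmorphD mulrDr.
  - by rewrite lamD rmorphD mulrDl.
  - by rewrite lamZ // !rmorphM (tensor_comm V'_tensor) mulrCA mulrA.
exists g => //; split=> [r t|t]; last first.
  have [s ->] := tensor_span V'_tensor t; rewrite raddf_sum rpred_sum // => z _.
  by rewrite gE subtensor_pure.
elim/subtensor_ind => [|c v u cS IH]; first by rewrite !mul0r raddf0.
rewrite !mulrDl raddfD IH; congr (_ + _); have [s ->] := tensor_span V'_tensor t.
rewrite mulr_sumr !raddf_sum mulr_sumr; apply: eq_bigr => z _.
by rewrite mulrACA -!rmorphM !gE lamZ // !rmorphM mulrACA.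
Qed.

(** Were t contracted into the kernel of eps by every functional, it would be
    a combination of elements of that kernel. This is how witnesses found in
    V' are brought down to S (x) V. *)
Lemma projector_separates t : eps t != 0 ->
  exists2 g : {additive V' -> V'}, projector g & eps (g t) != 0.
Proof.
move=> t0; apply: contrapT => h; move/eqP: t0; apply.
have {h}h (g : {additive V' -> V'}) : projector g -> eps (g t) = 0.
  by move=> gp; apply: contrapT => /eqP gt; apply: h; exists g.
have [s tE] := tensor_span V'_tensor t.
have [||||||||s' sJ E] := @coefficients_in _ _ S_subfield V' (fun x y => a x * y)
    (fun y => eps y = 0) [seq (z.1, b z.2) | z <- s].
- by move=> c d y _ _; rewrite rmorphM mulrA.
- by move=> c d y _ _; rewrite rmorphD mulrDl.
- by move=> c y z; rewrite mulrDr.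
- by move=> y; rewrite rmorph1 mul1r.
- exact: rmorph0.
- by move=> y z y0 z0; rewrite rmorphB y0 z0 subrr.
- by move=> c y _ y0; rewrite rmorphM y0 mulr0.
- move=> lam flam; have [g gp gE] := functional_projector flam.
  have := h g gp; rewrite tE raddf_sum big_map.
  by move=> <-; congr (eps _); apply: eq_bigr => z _ /=; rewrite gE.
have := E V' (fun x y => a x * y); rewrite big_map -tE => <-.
  rewrite raddf_sum big_seq big1 // => z zs.
  by rewrite /= rmorphM (sJ _ (map_f snd zs)) mulr0.
split=> [x y z|y x z|c _ x y]; rewrite ?mulrDr ?rmorphD ?mulrDl //.
by rewrite rmorphM mulrCA mulrA.
Qed.

(** The local ring of S (x) V at the contraction of the kernel of eps. *)
Definition subloc : {pred W} := [pred y | `[< exists x s,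
  [/\ x \in subtensor, s \in subtensor, eps s != 0 & y = l x / l s] >]].

Lemma subloc_frac x s : x \in subtensor -> s \in subtensor -> eps s != 0 ->
  l x / l s \in subloc.
Proof. by move=> xS sS s0; apply/asboolP; exists x, s. Qed.

Lemma subloc_l x : x \in subtensor -> l x \in subloc.
Proof.
move=> xS; rewrite -[l x]divr1 -(rmorph1 l) subloc_frac ?rpred1 //.
by rewrite rmorph1 oner_eq0.
Qed.

Lemma subloc_subring : subring_closed subloc.
Proof.
split; first by rewrite -(rmorph1 l) subloc_l ?rpred1.
- move=> _ _ /asboolP[x [s [xS sS s0 ->]]] /asboolP[y [t [yS tS t0 ->]]].
  have [ls lt] := (loc_unit s0, loc_unit t0).
  have -> : l x / l s - l y / l t = l (x * t - y * s) / l (s * t).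
    rewrite rmorphB !rmorphM invrM // mulrBl; congr (_ - _).
      by rewrite mulrA mulrK.
    by rewrite [_^-1 * _]mulrC mulrA mulrK.
  by rewrite subloc_frac ?rpredB ?rpredM // rmorphM mulf_neq0.
- move=> _ _ /asboolP[x [s [xS sS s0 ->]]] /asboolP[y [t [yS tS t0 ->]]].
  have [ls lt] := (loc_unit s0, loc_unit t0).
  have -> : (l x / l s) * (l y / l t) = l (x * y) / l (s * t).
    by rewrite !rmorphM invrM // mulrACA [_^-1 * _]mulrC.
  by rewrite subloc_frac ?rpredM // rmorphM mulf_neq0.
Qed.

HB.instance Definition _ := GRing.isSubringClosed.Build W subloc subloc_subring.

Lemma subloc_inv : {in subloc, forall x, x \is a GRing.unit -> x^-1 \in subloc}.
Proof.
move=> _ /asboolP[x [s [xS sS s0 ->]]]; rewrite unitrM loc_unitE => /andP[x0 _].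
have [ls lx] := (loc_unit s0, loc_unit x0).
by rewrite invrM ?unitrV // invrK subloc_frac.
Qed.

Lemma subloc_denominator n (t : 'I_n -> W) : (forall j, t j \in subloc) ->
  exists s (r : 'I_n -> V'), [/\ s \in subtensor, eps s != 0
    & forall j, r j \in subtensor /\ l (r j) = l s * t j].
Proof.
move=> /(_ _)/asboolP tU.
have /choice[xs xsP] : forall j, exists xs : V' * V',
    [/\ xs.1 \in subtensor, xs.2 \in subtensor, eps xs.2 != 0 & t j = l xs.1 / l xs.2].
  by move=> j; have [x [s xs]] := tU j; exists (x, s).
exists (\prod_j (xs j).2), (fun j => (xs j).1 * \prod_(j' | j' != j) (xs j').2).
split=> [||j].
- by rewrite rpred_prod // => j _; have [] := xsP j.
- by rewrite rmorph_prod; apply/prodf_neq0 => j _; have [] := xsP j.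
have [xS sS s0 tE] := xsP j; split.
  by rewrite rpredM // rpred_prod // => j' _; have [] := xsP j'.
rewrite [X in l X * _](bigD1 j) //= !rmorphM [RHS]mulrAC tE; congr (_ * _).
by rewrite mulrC divrK // loc_unit.
Qed.

(** The property of S that is propagated to all of k'. *)
Definition monomial_over : Prop := forall w, w \in subtensor ->
  exists v u, u \is a GRing.unit /\ l w = l (b v) * u.

(** The unit may be taken in the smaller local ring: a projector turns the
    witnesses into elements of S (x) V, and V acts without torsion. *)
Lemma monomial_subloc : monomial_over -> forall y, y \in subloc ->
  exists v u, [/\ u \in subloc, u \is a GRing.unit & y = l (b v) * u].
Proof.
move=> mono _ /asboolP[w [s [wS sS s0 ->]]].
have ls := loc_unit s0; have [v [u [uu wE]]] := mono w wS.
have [v0|v0] := eqVneq v 0.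
  exists 0, 1; rewrite rpred1 unitr1; split=> //.
  by rewrite wE v0 !rmorph0 !mul0r.
exists v, (u / l s); split; last by rewrite wE mulrA.
  apply: rpredM; last by apply: subloc_inv => //; exact: subloc_l.
  have [y [t [t0 uE]]] := loc_frac u.
  have lt := loc_unit t0.
  have [|r r0 rE] := @loc_eq (t * w) (b v * y).
    by rewrite !rmorphM wE uE mulrCA; congr (_ * _); rewrite mulrC divrK.
  have [g [gZ gS] gt] : exists2 g : {additive V' -> V'}, projector g & eps (g (r * t)) != 0.
    by apply: projector_separates; rewrite rmorphM mulf_neq0.
  have E : w * g (r * t) = b v * g (r * y).
    by rewrite -!gZ // ?subtensor_b // mulrC -mulrA rE mulrCA.
  have lg := loc_unit gt.
  suff -> : u = l (g (r * y)) / l (g (r * t)) by apply: subloc_frac.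
  apply: (mulIr lg); rewrite divrK //; apply/eqP; rewrite -subr_eq0; apply/eqP.
  apply: (beta_regular v0); rewrite mulrBr mulrA -wE -!rmorphM E.
  by rewrite subrr.
by rewrite unitrM uu unitrV.
Qed.

Lemma subloc_total : monomial_over -> {in subloc &, forall x y,
  (exists2 c, c \in subloc & x = c * y) \/ (exists2 c, c \in subloc & y = c * x)}.
Proof.
move=> mono x y /(monomial_subloc mono)[v [u [uS uu ->]]] /(monomial_subloc mono)[v' [u' [u'S u'u ->]]].
have key c w w' : w \in subloc -> w' \in subloc -> w' \is a GRing.unit ->
    exists2 d, d \in subloc & forall v, l (b (c * v)) * w = d * (l (b v) * w').
  move=> wS w'S w'u; exists (l (b c) * w / w').
    by rewrite !rpredM ?subloc_inv // subloc_l ?subtensor_b.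
  by move=> t; rewrite [RHS]mulrACA mulVr // mulr1 !rmorphM mulrAC.
have [[c ->]|[c ->]] := V_total v v'.
  by left; have [d dS dE] := key c u u' uS u'S u'u; exists d.
by right; have [d dS dE] := key c u' u u'S uS uu; exists d.
Qed.

End Subfield.

Section Adjunction.
Variables (S : divringClosed k') (z : k').
Hypothesis phi_S : forall c, phi c \in S.

(** The subfield S(z). *)
Definition adjoin : {pred k'} := [pred x | `[< exists p q : {poly k'},
  [/\ p \is a polyOver S, q \is a polyOver S, q.[z] != 0 & x = p.[z] / q.[z]] >]].

Lemma horner_one (R : nzRingType) (x : R) : (1 : {poly R}).[x] = 1.
Proof. by rewrite -polyC1 hornerC. Qed.

Lemma adjoin_divring : divring_closed adjoin.
Proof.
split.
- by apply/asboolP; exists 1, 1; rewrite !rpred1 ?horner_one ?hornerE oner_eq0 ?divr1 ?invr1.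
- move=> _ _ /asboolP[p [q [pS qS q0 ->]]] /asboolP[p' [q' [p'S q'S q'0 ->]]].
  apply/asboolP; exists (p * q' - p' * q), (q * q'); split.
  + by rewrite rpredB ?rpredM.
  + by rewrite rpredM.
  + by rewrite hornerM mulf_neq0.
  + by rewrite -mulNr addf_div // !hornerE mulNr.
- move=> _ _ /asboolP[p [q [pS qS q0 ->]]] /asboolP[p' [q' [p'S q'S q'0 ->]]].
  apply/asboolP; have [p'0|p'0] := eqVneq p'.[z] 0.
    exists 0, 1; rewrite rpred0 rpred1 ?horner0 ?horner_one ?hornerE oner_eq0; split=> //.
    by rewrite p'0 mul0r invr0 mulr0.
  exists (p * q'), (q * p'); split; rewrite ?rpredM // hornerM ?mulf_neq0 //.
  by rewrite invf_div mulf_div hornerM.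
Qed.

HB.instance Definition _ := GRing.isDivringClosed.Build k' adjoin adjoin_divring.

Lemma adjoin_S x : x \in S -> x \in adjoin.
Proof.
move=> xS; apply/asboolP; exists x%:P, 1.
by rewrite polyOverC xS rpred1 ?horner_one ?hornerE oner_eq0 ?invr1 ?mulr1.
Qed.

Lemma adjoin_z : z \in adjoin.
Proof.
apply/asboolP; exists 'X, 1.
by rewrite polyOverX rpred1 ?horner_one ?hornerE oner_eq0 ?invr1 ?mulr1.
Qed.

Lemma subtensor_sub t : t \in subtensor S -> t \in subtensor adjoin.
Proof.
by move=> /asboolP[s sS ->]; apply/asboolP; exists s => // x /sS; apply: adjoin_S.
Qed.

Lemma subtensor_horner Q : Q \is a polyOver (subtensor S) -> Q.[a z] \in subtensor adjoin.
Proof.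
move=> /polyOverP QS; rewrite horner_coef rpred_sum // => j _.
apply: rpredM; first exact/subtensor_sub/QS.
by apply/rpredX/subtensor_a; exact: adjoin_z.
Qed.

Lemma polyOver_map q : q \is a polyOver S -> map_poly a q \is a polyOver (subtensor S).
Proof. by move=> /polyOverP qS; apply/polyOverP => j; rewrite coef_map subtensor_a. Qed.

(** Clearing denominators, which are units of V'. *)
Lemma adjoin_clear t : t \in subtensor adjoin -> exists q Q,
  [/\ q.[z] != 0, Q \is a polyOver (subtensor S) & a q.[z] * t = Q.[a z]].
Proof.
move=> tS; suff [q [Q [_ q0 QS E]]] : exists q Q, [/\ q \is a polyOver S, q.[z] != 0,
  Q \is a polyOver (subtensor S) & a q.[z] * t = Q.[a z]] by exists q, Q.
elim/subtensor_ind: tS => [|x v u /asboolP[p [r [pS rS r0 ->]]] [q [Q [qS q0 QS E]]]].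
  by exists 1, 0; rewrite !rpred1 rpred0 ?horner_one ?hornerE oner_eq0 ?mulr0.
exists (r * q), (map_poly a (q * p) * (b v)%:P + map_poly a r * Q); split.
- by rewrite rpredM.
- by rewrite hornerM mulf_neq0.
- by rewrite rpredD ?rpredM ?polyOver_map ?rpredM // polyOverC subtensor_b.
rewrite !hornerE !horner_map !hornerM /= -E mulrDr; congr (_ + _).
  rewrite mulrA -rmorphM; congr (a _ * _).
  by rewrite [_ * q.[z]]mulrC -mulrA; congr (_ * _); rewrite mulrC divfK.
by rewrite mulrA -rmorphM.
Qed.

Lemma descend_adjoin s c y w : eps s != 0 -> w \in subtensor adjoin -> s * w = b c * y ->
  exists2 Q, Q \is a polyOver (subtensor S) &
    eps Q.[a z] != 0 /\ exists t, Q.[a z] * w = b c * t.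
Proof.
move=> s0 wS swE; have phi_adjoin d : phi d \in adjoin by rewrite adjoin_S.
have [g [gZ gS] gs] := projector_separates phi_adjoin s0.
have [q [Q [q0 QS QE]]] := adjoin_clear (gS s).
exists Q => //; rewrite -QE; split; first by rewrite rmorphM mulf_neq0 ?eps_a.
exists (a q.[z] * g y); rewrite -mulrA [g s * w]mulrC -[w * g s]gZ // [w * s]mulrC swE.
by rewrite gZ ?subtensor_b // mulrCA.
Qed.

Definition independent_powers (N : nat) : Prop :=
  forall q, q \is a polyOver S -> (size q <= N)%N -> q.[z] = 0 -> q = 0.

(** Coordinates along the powers of z, read off by projectors. *)
Lemma coordinate N j : independent_powers N -> (j < N)%N ->
  exists2 g : {additive V' -> V'}, projector S g &
    forall Q, Q \is a polyOver (subtensor S) -> (size Q <= N)%N -> g Q.[a z] = Q`_j.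
Proof.
move=> indep jN.
pose U x := exists2 q, q \is a polyOver S & [/\ (size q <= N)%N, q`_j = 0 & x = q.[z]].
have [||||lam [flam lamj lam0]] := @exists_functional _ _ (S_subfield S) U (z ^+ j).
- by exists 0; rewrite ?rpred0 // size_poly0 coef0 horner0.
- move=> _ _ [p pS [sp p0 ->]] [q qS [sq q0 ->]]; exists (p + q); first by rewrite rpredD.
  rewrite coefD p0 q0 addr0 hornerD; split=> //.
  by rewrite (leq_trans (size_polyD _ _)) // geq_max sp.
- move=> c _ cS [q qS [sq q0 ->]]; exists (c *: q); first by rewrite polyOverZ.
  rewrite coefZ q0 mulr0 hornerZ; split=> //.
  by rewrite (leq_trans (size_scale_leq _ _)).
- move=> [q qS [sq q0 zE]]; have : 'X^j - q = 0.
    apply: indep; first by rewrite rpredB // rpredX // polyOverX.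
      by rewrite (leq_trans (size_polyD _ _)) // size_polyN geq_max size_polyXn jN.
    by rewrite hornerD hornerN hornerXn zE subrr.
  move/(congr1 (fun p : {poly k'} => p`_j)); rewrite coefB coefXn eqxx q0 subr0 coef0.
  by move/eqP; rewrite oner_eq0.
have [g [gZ gS] gE] := functional_projector phi_S flam.
exists g => // Q QS sQ; rewrite (horner_coef_wide _ sQ) raddf_sum (bigD1 (Ordinal jN)) //=.
have E m : g (Q`_m * a z ^+ m) = Q`_m * a (lam (z ^+ m)).
  rewrite gZ ?(polyOverP QS) // -rmorphXn -[a _]mulr1 -(rmorph1 b) gE.
  by rewrite rmorph1 mulr1.
rewrite E lamj rmorph1 mulr1 big1 ?addr0 // => m mj.
rewrite E lam0 ?rmorph0 ?mulr0 //; exists 'X^m; first by rewrite rpredX // polyOverX.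
rewrite size_polyXn ltn_ord coefXn hornerXn; split=> //.
by rewrite -(inj_eq val_inj) /= in mj; rewrite eq_sym (negPf mj).
Qed.

Definition monomial_values : Prop := forall Q, Q \is a polyOver (subtensor S) ->
  exists v u, u \is a GRing.unit /\ l Q.[a z] = l (b v) * u.

Lemma monomial_adjoin : monomial_values -> monomial_over adjoin.
Proof.
move=> H w /adjoin_clear[q [Q [q0 QS QE]]].
have [v [u [uu uE]]] := H Q QS.
have aq : l (a q.[z]) \is a GRing.unit by rewrite loc_unit // eps_a.
exists v, (u / l (a q.[z])); split; first by rewrite unitrM uu unitrV.
by apply: (mulIr aq); rewrite mulrA divrK // -uE -QE rmorphM mulrC.
Qed.

(** A Gauss content argument: the powers of z are independent modulo the
    kernel of eps, so a polynomial with a unit coefficient takes a unit value. *)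
Lemma monomial_transcendental :
    (forall N, independent_powers N) -> monomial_over S -> monomial_values.
Proof.
move=> indep mono Q QS; have [Q0|Q0] := eqVneq Q 0.
  by exists 0, 1; rewrite unitr1 Q0 horner0 !rmorph0 mul0r.
set n := size Q; have n0 : (0 < n)%N by rewrite size_poly_gt0.
have /choice[vu vuP] : forall j : 'I_n, exists vu : V * W,
    [/\ vu.2 \in subloc S, vu.2 \is a GRing.unit & l Q`_j = l (b vu.1) * vu.2].
  move=> j; have [|v [u vuP]] := monomial_subloc phi_S mono (y := l Q`_j).
    by rewrite subloc_l // (polyOverP QS).
  by exists (v, u).
have [j0 j0P] : exists j0, forall j, exists c, (vu j).1 = c * (vu j0).1.
  have [|||||_ /mapP[j0 _ ->] j0P] := @least_element V (fun=> True)
      (fun x y => exists c, y = c * x) [seq (vu j).1 | j <- enum 'I_n].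
  - by move=> x _; exists 1; rewrite mul1r.
  - by move=> x y t [c ->] [d ->]; exists (d * c); rewrite mulrA.
  - by move=> x y _ _; have [] := V_total x y; [right|left].
  - by rewrite -size_eq0 size_map size_enum_ord -lt0n.
  - by [].
  by exists j0 => j; apply: j0P; apply/mapP; exists j; rewrite ?mem_enum.
set v := (vu j0).1 in j0P; have [v0|v0] := eqVneq v 0.
  exists 0, 1; rewrite unitr1 !rmorph0 mul0r; split=> //.
  rewrite horner_coef rmorph_sum big1 // => j _.
  rewrite rmorphM; have [_ _ ->] := vuP j; have [c ->] := j0P j.
  by rewrite v0 mulr0 !rmorph0 !mul0r.
have /choice[c cE] := j0P.
have tS j : l (b (c j)) * (vu j).2 \in subloc S.
  by have [uS _ _] := vuP j; rewrite rpredM // subloc_l // subtensor_b.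
have [s [r [sS s0 rP]]] := subloc_denominator tS.
pose R := \poly_(j < n) (if insub j is Some j' then r j' else 0).
have RE (j : 'I_n) : R`_j = r j by rewrite coef_poly ltn_ord valK.
have RS : R \is a polyOver (subtensor S).
  apply/polyOverP => j; rewrite coef_poly; case: ltnP => [jn|_]; last exact: rpred0.
  by rewrite insubT; have [] := rP (Ordinal jn).
have ls := loc_unit s0.
have lR : l Q.[a z] = l (b v) * (l R.[a z] / l s).
  rewrite mulrA; apply: (mulIr ls); rewrite divrK //.
  rewrite (horner_coef_wide _ (size_poly _ _)) horner_coef !rmorph_sum mulr_suml mulr_sumr.
  apply: eq_bigr => j _; rewrite RE !rmorphM; have [_ ->] := rP j.
  have [_ _ ->] := vuP j; rewrite cE !rmorphM [l (b (c j)) * _]mulrC -!mulrA.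
  by congr (_ * _); rewrite [RHS]mulrC -!mulrA.
exists v, (l R.[a z] / l s); split=> //.
rewrite unitrM unitrV ls andbT loc_unitE; apply/eqP => /eps_strict[s1 [c1 [y [s10 c1u s1E]]]].
have [Q1 Q1S [Q10 [t tE]]] := descend_adjoin s10 (subtensor_horner RS) s1E.
(* Both Q1 and R are nonzero modulo eps, but all coordinates of their product
   are multiples of the non-unit c1. *)
have : map_poly eps (Q1 * R) = 0.
  apply/polyP => j; rewrite coef_map coef0 /=.
  have [jn|jn] := ltnP j (size (Q1 * R)); last by rewrite nth_default ?rmorph0.
  have [g [gZ gS] gE] := coordinate (indep _) jn.
  rewrite -(gE _ _ (leqnn _)) ?rpredM // hornerM tE gZ ?subtensor_b // rmorphM.
  by have := eps_b c1; rewrite c1u => /eqP->; rewrite mul0r.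
rewrite rmorphM => /eqP; rewrite mulf_eq0 => /orP[] /eqP h0.
  by have := horner_map eps Q1 (a z); rewrite h0 horner0 => /esym/eqP; apply/negP.
have := congr1 (fun q : {poly kx} => q`_j0) h0; rewrite coef_map coef0 RE /=.
have cj0 : c j0 = 1.
  have /V_domain[/eqP|/eqP] : (c j0 - 1) * v = 0 by rewrite mulrBl mul1r -cE subrr.
    by rewrite subr_eq0 => /eqP.
  by rewrite (negPf v0).
apply/eqP; rewrite -loc_unitE; have [_ ->] := rP j0.
by rewrite cj0 !rmorph1 mul1r unitrM ls; have [_ ->] := vuP j0.
Qed.

Section Algebraic.
Variables (n : nat) (f : {poly k'}).
Hypothesis f_monic : f \is monic.
Hypothesis f_S : f \is a polyOver S.
Hypothesis f_root : f.[z] = 0.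
Hypothesis f_size : size f = n.+2.
Hypothesis f_minimal : independent_powers n.+1.

(** Division by the minimal polynomial f of z. *)
Lemma reduce_powers Q : Q \is a polyOver (subtensor S) -> exists2 Q',
  Q' \is a polyOver (subtensor S) & (size Q' <= n.+1)%N /\ Q'.[a z] = Q.[a z].
Proof.
elim/poly_ind: Q => [|Q c IH] /polyOverP QS.
  by exists 0; rewrite ?rpred0 // size_poly0.
have cS : c \in subtensor S.
  by have := QS 0%N; rewrite coefD coefMX coefC add0r.
have [|Q' Q'S [sQ' Q'E]] := IH.
  by apply/polyOverP => j; have := QS j.+1; rewrite coefD coefMX coefC addr0.
have fE : (map_poly a f).[a z] = 0 by rewrite horner_map f_root rmorph0.
exists (Q' * 'X - Q'`_n *: map_poly a f + c%:P).
  rewrite rpredD ?polyOverC // rpredB ?rpredM ?polyOverX ?polyOverZ ?polyOver_map //.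
  exact: (polyOverP Q'S).
split; last by rewrite !hornerE fE mulr0 subr0 Q'E.
apply/leq_sizeP => j nj; rewrite coefD coefB coefMX coefZ coef_map coefC /=.
case: j nj => // j nj; rewrite /= addr0; have [jn|jn] := eqVneq j n.
  move/monicP: f_monic; rewrite jn /lead_coef f_size /= => ->.
  by rewrite rmorph1 mulr1 subrr.
have {}nj : (n < j)%N by rewrite ltn_neqAle eq_sym jn.
have fj : f`_j.+1 = 0 by rewrite nth_default // f_size.
have Qj : Q'`_j = 0 by rewrite nth_default // (leq_trans sQ').
by rewrite fj Qj rmorph0 mulr0 subrr.
Qed.

Lemma coordinates_exist : exists g : 'I_n.+1 -> {additive V' -> V'},
  forall j, projector S (g j) /\ forall Q, Q \is a polyOver (subtensor S) ->
    (size Q <= n.+1)%N -> g j Q.[a z] = Q`_j.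
Proof.
have h (j : 'I_n.+1) : exists g : {additive V' -> V'}, projector S g /\
    forall Q, Q \is a polyOver (subtensor S) -> (size Q <= n.+1)%N -> g Q.[a z] = Q`_j.
  by have [g gp gE] := coordinate f_minimal (ltn_ord j); exists g.
by have [g gP] := choice h; exists g.
Qed.

(** The elements of [subloc S] that divide a multiple of w by an element
    outside the kernel of eps have a largest member gam, because the multiplier
    can be taken among the polynomials in z of degree at most n. Dividing w by
    gam leaves a unit: otherwise eps_strict provides a non-unit c1 such that
    gam c1 is again such a divisor. *)
Lemma monomial_algebraic : monomial_over S -> monomial_values.
Proof.
move=> mono Qw QwS; set w := Qw.[a z].
have [g gP] := coordinates_exist.
have expand Q : Q \is a polyOver (subtensor S) ->
    Q.[a z] = \sum_j g j Q.[a z] * a z ^+ j.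
  move=> QS; have [Q' Q'S [sQ' <-]] := reduce_powers QS.
  rewrite {1}(horner_coef_wide _ sQ'); apply: eq_bigr => j _.
  by have [_ ->] := gP j.
pose e (j : 'I_n.+1) := l (a z ^+ j).
pose M (j j' : 'I_n.+1) := l (g j' (w * a z ^+ j)).
have gZ j r t : r \in subtensor S -> g j (r * t) = r * g j t.
  by move=> rS; have [[-> //]] := gP j.
have gS j t : g j t \in subtensor S by have [[_ ->]] := gP j.
have MS j j' : M j j' \in subloc S by rewrite subloc_l.
have Me (r : 'I_n.+1 -> V') j' : (forall j, r j \in subtensor S) ->
    \sum_j l (r j) * M j j' = l (g j' (w * \sum_j r j * a z ^+ j)).
  move=> rS; rewrite mulr_sumr !raddf_sum; apply: eq_bigr => j _.
  by rewrite /M -rmorphM -gZ // mulrCA.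
have De : divides_combination (subloc S) e M 1.
  exists (fun j => (j == ord0)%:R) => [j|]; first by case: eqP; rewrite ?rpred0 ?rpred1.
  split=> [|j].
    rewrite (bigD1 ord0) //= big1 => [|j /negPf->]; last by rewrite mul0r.
    by rewrite mul1r addr0 /e expr0 rmorph1 unitr1.
  exists (\sum_j' (j' == ord0)%:R * M j' j); last by rewrite mul1r.
  by rewrite rpred_sum // => j' _; rewrite rpredM //; case: eqP; rewrite ?rpred0 ?rpred1.
have [gam gamS [[c cS [ce cM]] gam_max]] := largest_divisor (@subloc_inv S)
  (subloc_total phi_S mono) loc_local MS (ex_intro _ _ De).
have [v [u [uS uu gamE]]] := monomial_subloc phi_S mono gamS.
have [s [r [sS s0 rP]]] := subloc_denominator cS.
have ls := loc_unit s0.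
pose x := \sum_j r j * a z ^+ j.
have rS j : r j \in subtensor S by have [] := rP j.
have lx : l x = l s * \sum_j c j * e j.
  rewrite rmorph_sum mulr_sumr; apply: eq_bigr => j _.
  by rewrite rmorphM; have [_ ->] := rP j; rewrite mulrA.
have lxu : l x \is a GRing.unit by rewrite lx unitrM ls.
pose Qx := \poly_(j < n.+1) (if insub j is Some j' then r j' else 0).
have QxS : Qx \is a polyOver (subtensor S).
  apply/polyOverP => j; rewrite coef_poly; case: ltnP => [jn|_]; last exact: rpred0.
  by rewrite insubT.
have QxE : Qx.[a z] = x.
  rewrite (horner_coef_wide _ (size_poly _ _)); apply: eq_bigr => j _.
  by rewrite coef_poly ltn_ord valK.
have [y wE] : exists y, l w = l (b v) * y.
  have /choice[t tP] : forall j, exists t, t \in subloc S /\ \sum_j' c j' * M j' j = gam * t.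
    by move=> j; have [t tS tE] := cM j; exists t.
  have lwx : l (w * x) = l (b v) * (u * (l s * \sum_j t j * e j)).
    rewrite -QxE -hornerM expand ?rpredM // hornerM QxE rmorph_sum.
    rewrite [X in _ = _ * (_ * X)]mulr_sumr [X in _ = _ * X]mulr_sumr [RHS]mulr_sumr.
    apply: eq_bigr => j _; rewrite rmorphM -/w /x -(Me r j rS).
    under eq_bigr => j' _ do (have [_ ->] := rP j'); rewrite -/(e j).
    under eq_bigr do rewrite -mulrA.
    by rewrite -mulr_sumr; have [_ ->] := tP j; rewrite gamE !mulrA; congr (_ * _ * _);
       rewrite -!mulrA mulrCA; congr (_ * _); rewrite mulrC.
  exists (u * (l s * \sum_j t j * e j) / l x); apply: (mulIr lxu).
  by rewrite mulrA divrK // -lwx rmorphM.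
have [v0|v0] := eqVneq v 0.
  by exists 0, 1; rewrite unitr1 wE v0 !rmorph0 !mul0r.
have [yu|/nonunit_beta[c1 [y1 [c1u yE]]]] := boolP (y \is a GRing.unit); first by exists v, y.
exfalso; move/negP: c1u; apply.
have [y2 [s1 [s10 y1E]]] := loc_frac y1; have ls1 := loc_unit s10.
have [|s2 s20 s2E] := @loc_eq (s1 * w) (b (v * c1) * y2).
  rewrite !rmorphM wE yE y1E mulrC -!mulrA; congr (_ * (_ * _)).
  by rewrite mulVr ?mulr1.
have [|||Q1 Q1S [Q10 [t tE]]] := @descend_adjoin (s2 * s1) (v * c1) (s2 * y2) w.
- by rewrite rmorphM mulf_neq0.
- exact: subtensor_horner.
- by rewrite -mulrA s2E mulrCA.
have [Q2 Q2S [sQ2 Q2E]] := reduce_powers Q1S.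
have Q2sum : \sum_(j < n.+1) Q2`_j * a z ^+ j = Q1.[a z].
  by rewrite -Q2E (horner_coef_wide _ sQ2).
have [|d dS gamd] := gam_max (l (b (v * c1))).
  exists (fun j => l Q2`_j) => [j|]; first by rewrite subloc_l // (polyOverP Q2S).
  split=> [|j'].
    rewrite [X in X \is a _](_ : _ = l Q1.[a z]) ?loc_unitE // -Q2sum rmorph_sum.
    by apply: eq_bigr => j _; rewrite rmorphM.
  exists (l (g j' t)); first by rewrite subloc_l.
  rewrite Me => [|j]; last exact: (polyOverP Q2S).
  by rewrite Q2sum mulrC tE gZ ?subtensor_b // rmorphM.
rewrite -beta_unit; have : u = l (b c1) * d.
  apply/eqP; rewrite -subr_eq0; apply/eqP/(beta_regular v0).
  by rewrite mulrBr -gamE gamd !rmorphM mulrA subrr.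
by move=> uE; move: uu; rewrite uE unitrM => /andP[].
Qed.

End Algebraic.
End Adjunction.

Lemma monomial_adjunction (S : divringClosed k') (z : k') :
  (forall c, phi c \in S) -> monomial_over S -> monomial_over (adjoin S z).
Proof.
move=> phi_S mono; apply: monomial_adjoin.
have [indep|/existsNP[N /existsNP[q /not_implyP[qS /not_implyP[sq /not_implyP[q0 qn0]]]]]] :=
  pselect (forall N, independent_powers S z N); first exact: monomial_transcendental.
pose Q m := `[< exists q, [/\ q \is a polyOver S, q != 0, q.[z] = 0 & size q = m] >].
have exQ : exists m, Q m by exists (size q); apply/asboolP; exists q; split=> //; exact/eqP.
case: (ex_minnP exQ) => m /asboolP[{qS sq q0 qn0}q [qS q0 qz sq]] min_m.
have lead0 : lead_coef q != 0 by rewrite lead_coef_eq0.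
have [n mE] : exists n, m = n.+2.
  case: m sq min_m => [/eqP|[|n _ _]]; last by exists n.
    by rewrite size_poly_eq0 (negPf q0).
  move=> /eqP/size_poly1P[c c0 qE]; move/eqP: qz.
  by rewrite qE hornerC (negPf c0).
apply: (@monomial_algebraic S z phi_S n ((lead_coef q)^-1 *: q)) => //.
- by rewrite monicE lead_coefZ mulVf.
- by rewrite polyOverZ // rpredV; exact: (polyOverP qS).
- by rewrite hornerZ qz mulr0.
- by rewrite size_scale ?invr_eq0 // sq.
move=> r rS sr rz; apply: contrapT => /eqP r0.
have : (m <= size r)%N by apply: min_m; apply/asboolP; exists r.
by rewrite mE => /leq_trans/(_ sr); rewrite ltnn.
Qed.

Lemma monomial_base : exists2 S : divringClosed k', S =i image_of phi & monomial_over S.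
Proof.
have dr : divring_closed (image_of phi).
  have [S1 SB SM SV] := image_subfield phi; split=> // x y xS yS.
  have [->|y0] := eqVneq y 0; first by rewrite invr0 mulr0; apply/image_ofP; exists 0; rewrite rmorph0.
  apply: SM => //; have [y' y'S E] := SV y yS y0.
  by rewrite -[y^-1]mulr1 -E mulKf.
pose S : divringClosed k' := HB.pack (image_of phi) (GRing.isDivringClosed.Build _ _ dr).
exists S => // w wS; suff [v ->] : exists v, w = b v by exists v, 1; rewrite unitr1 mulr1.
elim/subtensor_ind: wS => [|x v t /image_ofP[c ->] [v' ->]]; first by exists 0; rewrite rmorph0.
by exists (i c * v + v'); rewrite rmorphD rmorphM (tensor_comm V'_tensor).
Qed.

(** A subfield S maximal for [monomial_over] is k', because S(z) inherits the
    property. *)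
Theorem localization_monomial w : exists v u, u \is a GRing.unit /\ l w = l (b v) * u.
Proof.
(* The image of k is always added, so that the empty chain has an upper bound. *)
pose pr (X : set k') : {pred k'} := [pred x | `[< x \in image_of phi \/ X x >]].
pose P (X : set k') := exists2 S : divringClosed k', S =i pr X & monomial_over S.
have [F FP Ftot|A [[S SA mono] maxA]] := @Zorn_bigcup k' P.
  have key (xs : seq k') : (forall x, x \in xs -> x \in pr (\bigcup_(X in F) X)%classic) ->
      exists S : divringClosed k', [/\ forall x, x \in xs -> x \in S,
        {subset S <= pr (\bigcup_(X in F) X)%classic} & monomial_over S].
    move=> xsY.
    have [xs0|[X FX xsX]] : (forall x, x \in xs -> x \in image_of phi) \/
        (exists2 X, F X & forall x, x \in xs -> x \in pr X).
    - elim: xs xsY => [|x xs IH] xsY; first by left.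
      have xX : x \in image_of phi \/ exists2 X, F X & X x.
        by have /asboolP[|] := xsY x (mem_head _ _); [left|right].
      have sub X y : y \in image_of phi -> y \in pr X by move=> yi; apply/asboolP; left.
      have [|xs0|[X FX xsX]] := IH.
      + by move=> y yxs; apply: xsY; rewrite inE yxs orbT.
      + case: xX => [xi|[X FX Xx]]; [left|right].
          by move=> y; rewrite inE => /predU1P[->|/xs0].
        exists X => // y; rewrite inE => /predU1P[->|/xs0/sub//].
        by apply/asboolP; right.
      + right; case: xX => [xi|[Z FZ Zx]].
          by exists X => // y; rewrite inE => /predU1P[->|/xsX//]; exact: sub.
        have [ZX|XZ] := Ftot _ _ FZ FX.
          exists X => // y; rewrite inE => /predU1P[->|/xsX//].
          by apply/asboolP; right; apply: ZX.
        exists Z => // y; rewrite inE => /predU1P[->|/xsX/asboolP[/sub//|Xy]].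
          by apply/asboolP; right.
        by apply/asboolP; right; apply: XZ.
    - have [S SE mono] := monomial_base; exists S; split=> // x; first by rewrite SE; exact: xs0.
      by rewrite SE => xi; apply/asboolP; left.
    - have [S SE mono] := FP X FX; exists S; split=> // x; first by rewrite SE; exact: xsX.
      by rewrite SE => /asboolP[xi|Xx]; apply/asboolP; [left|right; exists X].
  have dr : divring_closed (pr (\bigcup_(X in F) X)%classic).
    split.
    - by have [//|S [_ sub _]] := key [::]; apply: sub; exact: rpred1.
    - move=> x y xY yY; have [|S [xyS sub _]] := key [:: x; y].
        by move=> t; rewrite mem_seq2 => /orP[]/eqP->.
      by apply: sub; apply: rpredB; apply: (xyS); rewrite !inE eqxx ?orbT.
    - move=> x y xY yY; have [|S [xyS sub _]] := key [:: x; y].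
        by move=> t; rewrite mem_seq2 => /orP[]/eqP->.
      by apply: sub; apply: rpred_div; apply: (xyS); rewrite !inE eqxx ?orbT.
  exists (HB.pack_for (divringClosed k') (pr (\bigcup_(X in F) X)%classic)
    (GRing.isDivringClosed.Build _ _ dr)) => // x /asboolP[s sS xE].
  have [|S [xsS _ mono]] := key (map fst s); first by move=> y /mapP[t ts ->]; exact: sS.
  by apply: mono; apply/asboolP; exists s => // t ts; apply: xsS; rewrite map_f.
have phi_S c : phi c \in S by rewrite SA; apply/asboolP; left; exact: mem_image_of.
have S_all z : z \in S.
  apply: contrapT => zS; apply: (maxA [set x | x \in adjoin S z]%classic).
    split; first by move=> x Ax; apply: adjoin_S; rewrite SA; apply/asboolP; right.
    by move=> /(_ z (adjoin_z S z)) Az; apply: zS; rewrite SA; apply/asboolP; right.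
  exists (GRing.DivringClosed.clone _ (adjoin S z) _); last exact: monomial_adjunction.
  move=> x; apply/idP/asboolP => [xS|[/image_ofP[c ->]|//]]; first by right.
  exact: adjoin_S.
apply: mono; have [s ->] := tensor_span V'_tensor w.
by apply/asboolP; exists s.
Qed.

End Localization.

(** * Extensions of a valuation ring generated by units *)

Lemma bijective_of (X Y : Type) (f : X -> Y) :
  injective f -> (forall y, exists x, f x = y) -> bijective f.
Proof.
move=> f_inj /choice[g gP]; exists g => [x|//].
exact/f_inj/gP.
Qed.

Lemma valuation_ringP (V : comUnitRingType) : valuation_ring V ->
  (forall x y : V, x * y = 0 -> x = 0 \/ y = 0) /\
  (forall x y : V, (exists c, x = c * y) \/ (exists c, y = c * x)).
Proof.
move=> [K [i [[i_inj _] i_total]]].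
have i0 x : (i x == 0) = (x == 0) by rewrite -(inj_eq i_inj) rmorph0.
split=> [x y xy|x y].
  have := congr1 i xy; rewrite rmorphM rmorph0 => /eqP.
  by rewrite mulf_eq0 !i0 => /orP[]/eqP; [left|right].
have [->|y0] := eqVneq y 0; first by right; exists 0; rewrite mul0r.
have [[c cE]|[c cE]] := i_total (i x / i y).
  by left; exists c; apply: i_inj; rewrite rmorphM -cE divfK // i0.
have [->|x0] := eqVneq x 0; first by left; exists 0; rewrite mul0r.
by right; exists c; apply: i_inj; rewrite rmorphM -cE invf_div divfK // i0.
Qed.

Lemma fraction_fraction_field (D : idomainType) (y : {fraction D}) :
  exists x s : D, FracField.tofrac s != 0 /\ y = FracField.tofrac x / FracField.tofrac s.
Proof.
elim/quotW: y => r; exists (\n_r), (\d_r).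
have d0 : FracField.tofrac \d_r != 0 by rewrite tofrac_eq0 denom_ratioP.
split=> //; apply: (mulIf d0); rewrite divfK //.
unlock FracField.tofrac; rewrite -[LHS]FracField.pi_mul /FracField.mulf.
rewrite !numden_Ratio ?oner_eq0 //.
apply/eqmodP; rewrite /= FracField.equivfE !numden_Ratio ?oner_eq0 ?mulr1 ?denom_ratioP //.
by rewrite mulrC.
Qed.

Lemma idomain_fraction_field (D : idomainType) :
  exists (L : fieldType) (j : {rmorphism D -> L}), fraction_field j.
Proof.
exists {fraction D}, (GRing.RMorphism.clone _ _ (@FracField.tofrac D) _).
split=> [x y /eqP|]; last exact: fraction_fraction_field.
by rewrite tofrac_eq => /eqP.
Qed.

Section SpecIdeal.
Variables (R : comNzRingType) (q : spec R).

Lemma spec0 : 0 \in q. Proof. by have [] := spec_ideal q. Qed.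

Lemma spec1 : 1 \notin q. Proof. by have [] := spec_ideal q. Qed.

Lemma specM x y : y \in q -> x * y \in q.
Proof.
by move=> yq; have [_ _ qI] := spec_ideal q; rewrite -[_ * _]addr0 qI ?spec0.
Qed.

Lemma specD x y : x \in q -> y \in q -> x + y \in q.
Proof. by move=> xq yq; have [_ _ qI] := spec_ideal q; rewrite -[x]mul1r qI. Qed.

Lemma spec_mulr x y : x * y \in q -> x \in q \/ y \in q.
Proof. by move=> /(spec_prime (s := q))/orP. Qed.

End SpecIdeal.

Lemma spec_nonunit (R : comUnitRingType) (q : spec R) x : x \in q -> x \isn't a GRing.unit.
Proof.
by move=> xq; apply/negP => xu; have := spec1 q; rewrite -(mulVr xu) specM.
Qed.

Lemma spec_unitM (R : comUnitRingType) (q : spec R) x u :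
  u \is a GRing.unit -> x * u \in q -> x \in q.
Proof.
by move=> uu /spec_mulr[//|/spec_nonunit]; rewrite uu.
Qed.

Section MonomialExtension.
Variables (V W : comUnitRingType) (beta : {rmorphism V -> W}).
Hypothesis V_valuation : valuation_ring V.
Hypothesis W_monomial : forall y, exists v u, u \is a GRing.unit /\ y = beta v * u.
Hypothesis beta_local : forall v, (beta v \is a GRing.unit) = (v \is a GRing.unit).
Hypothesis beta_reg : forall v y, v != 0 -> beta v * y = 0 -> y = 0.

Let V_domain := (valuation_ringP V_valuation).1.
Let V_total := (valuation_ringP V_valuation).2.

Lemma monomial_injective : injective beta.
Proof.
move=> x y xy; apply/eqP; rewrite -subr_eq0; apply: contraT => xy0.
have /eqP : (1 : W) = 0 by apply: (beta_reg xy0); rewrite mulr1 rmorphB xy subrr.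
by rewrite oner_eq0.
Qed.

(** Divisibility in W between elements of V is divisibility in V: one of two
    elements of V divides the other, and beta reflects units. *)
Lemma monomial_dvd v v' y : beta v' = beta v * y -> exists c, v' = v * c.
Proof.
move=> E; have [[c ->]|[c vE]] := V_total v' v; first by exists c; rewrite mulrC.
have [v'0|v'0] := eqVneq v' 0; first by exists 0; rewrite mulr0.
have cy : beta c * y = 1.
  apply/eqP; rewrite -subr_eq0; apply/eqP/(beta_reg v'0).
  by rewrite mulrBr mulr1 {2}E vE rmorphM !mulrA [beta v' * _]mulrC subrr.
have cu : c \is a GRing.unit.
  by rewrite -beta_local; apply/unitrPr; exists y.
by exists c^-1; rewrite vE mulrAC divrr ?mul1r.
Qed.

Lemma monomial_domain (x y : W) : x * y = 0 -> x = 0 \/ y = 0.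
Proof.
have [v [u [uu ->]]] := W_monomial x; have [v' [u' [u'u ->]]] := W_monomial y.
rewrite mulrACA -rmorphM => /(congr1 ( *%R^~ (u * u')^-1)).
rewrite mulrK ?unitrM ?uu // mul0r -(rmorph0 beta) => /monomial_injective.
by move=> /V_domain[]->; [left|right]; rewrite rmorph0 mul0r.
Qed.

Lemma monomial_fraction_field : exists (L : fieldType) (j : {rmorphism W -> L}),
  fraction_field j.
Proof.
have W_axiom : GRing.integral_domain_axiom W.
  by move=> x y /monomial_domain[]->; rewrite eqxx ?orbT.
pose D : idomainType := HB.pack (GRing.ComUnitRing.sort W)
  (GRing.ComUnitRing_isIntegral.Build W W_axiom).
exact: (idomain_fraction_field D).
Qed.

(** Surjectivity on value groups is the hypothesis on W; injectivity holds
    because beta reflects units. *)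
Theorem monomial_weakly_unramified : weakly_unramified_extension beta.
Proof.
have [L [j [j_inj j_frac]]] := monomial_fraction_field.
have j0 y : (j y == 0) = (y == 0) by rewrite -(inj_eq j_inj) rmorph0.
have [K [i [[i_inj i_frac] i_total]]] := V_valuation.
have i0 x : (i x == 0) = (x == 0) by rewrite -(inj_eq i_inj) rmorph0.
have [g gE] : exists g : {rmorphism K -> L}, forall x, g (i x) = j (beta x).
  apply: (fraction_extension (h := j \o beta) i_frac) => x /=.
  by rewrite i0 j0 -(inj_eq monomial_injective) rmorph0.
have monomial_L (y : L) : y != 0 -> exists x u, [/\ u \is a GRing.unit, x != 0 & y = j u * g x].
  move=> y0; have [w1 [w2 [w20 yE]]] := j_frac y.
  have [v1 [u1 [u1u w1E]]] := W_monomial w1; have [v2 [u2 [u2u w2E]]] := W_monomial w2.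
  have yE' : y = j (u1 / u2) * g (i v1 / i v2).
    rewrite yE w1E w2E !rmorphM !fmorphV !gE /= rmorphV // invfM.
    by rewrite [LHS]mulrACA mulrC.
  exists (i v1 / i v2), (u1 / u2); split=> //; first by rewrite unitrM u1u unitrV.
  by apply: contraNneq y0 => x0; rewrite yE' x0 rmorph0 mulr0.
have W_total x : (exists y, x = j y) \/ (exists y, x^-1 = j y).
  have [->|x0] := eqVneq x 0; first by left; exists 0; rewrite rmorph0.
  have [t [u [uu _ ->]]] := monomial_L x x0.
  have [[c ->]|[c cE]] := i_total t; [left|right].
    by exists (u * beta c); rewrite rmorphM gE.
  exists (u^-1 * beta c); rewrite rmorphM -gE -cE rmorphV //.
  by rewrite invfM fmorphV.
split=> [||v|].
- by split=> //; exists L, j.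
- exact: monomial_injective.
- by rewrite beta_local.
exists K, L, i, j, g; split=> //.
apply: bijective_of => [x y|y].
  elim/quotW: x => x; elim/quotW: y => y; rewrite !(value_group_mapE gE).
  move=> /eqP; rewrite eqmodE => /asboolP[u uu /= xyE].
  apply/eqP; rewrite eqmodE; apply/asboolP.
  have key s t w : w \is a GRing.unit -> g t = j w * g s ->
      s != 0 -> (exists c, t / s = i c) -> exists2 c, c \is a GRing.unit & t = i c * s.
    move=> wu ts s0 [c cE]; have tE : t = i c * s by rewrite -cE divfK.
    exists c => //; rewrite -beta_local (_ : beta c = w) //; apply: j_inj.
    by rewrite -gE -cE rmorphM fmorphV ts mulfK ?fmorph_eq0.
  have [x0 y0] := (valP x, valP y).
  have [[c cE]|[c cE]] := i_total (val y / val x).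
    by apply: (key (val x) (val y) u uu xyE x0); exists c.
  have [|||c' c'u xE] := key (val y) (val x) u^-1 _ _ y0.
  - by rewrite unitrV.
  - by rewrite xyE mulrA -rmorphM mulVr // rmorph1 mul1r.
  - by exists c; rewrite -cE invf_div.
  exists c'^-1; first by rewrite unitrV.
  by rewrite xE mulrA -rmorphM mulVr // rmorph1 mul1r.
elim/quotW: y => y; have [x [u [uu x0 yE]]] := monomial_L (val y) (valP y).
exists (\pi_(value_group i) (exist _ x x0))%qT; rewrite (value_group_mapE gE).
by apply/eqP; rewrite eqmodE; apply/asboolP; exists u.
Qed.

(** The ideal generated by q consists of multiples of single elements of q,
    since of two elements of q one divides the other. *)
Lemma extended_idealr (q : spec V) :
  idealr_closed [pred y | `[< exists v u, v \in q /\ y = beta v * u >]].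
Proof.
split.
- by apply/asboolP; exists 0, 0; rewrite spec0 mulr0.
- apply/negP => /asboolP[v [u [vq E]]]; have := spec_nonunit vq.
  by rewrite -beta_local => /negP; apply; apply/unitrPr; exists u.
move=> c _ _ /asboolP[v [u [vq ->]]] /asboolP[v' [u' [v'q ->]]]; apply/asboolP.
have [[d ->]|[d ->]] := V_total v v'.
  exists v', (c * (beta d * u) + u'); split=> //.
  by rewrite mulrDr rmorphM [beta d * beta v']mulrC -mulrA; congr (_ + _); rewrite mulrCA.
exists v, (c * u + beta d * u'); split=> //.
by rewrite mulrDr mulrCA rmorphM [beta d * beta v]mulrC -mulrA.
Qed.

Lemma extended_prime (q : spec V) :
  prime_idealr_closed [pred y | `[< exists v u, v \in q /\ y = beta v * u >]].
Proof.
move=> x y /asboolP[v [u [vq]]].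
have [v1 [u1 [u1u ->]]] := W_monomial x; have [v2 [u2 [u2u ->]]] := W_monomial y.
move=> /(congr1 ( *%R^~ (u1 * u2)^-1)).
rewrite mulrACA mulrK ?unitrM ?u1u // -mulrA -rmorphM => /monomial_dvd[c cE].
have : v1 * v2 \in q by rewrite cE mulrC specM.
move=> /spec_mulr[v1q|v2q]; apply/orP; [left|right]; apply/asboolP.
  by exists v1, u1.
by exists v2, u2.
Qed.

Definition extended (q : spec V) : spec W := Spec (extended_idealr q) (@extended_prime q).

Lemma extendedP (q : spec V) y :
  reflect (exists v u, v \in q /\ y = beta v * u) (y \in extended q).
Proof. exact: asboolP. Qed.

Lemma extended_extension (q : spec V) :
  [set y | y \in extended q]%classic = extension_ideal beta q.
Proof.
apply/seteqP; split=> y.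
  move=> /extendedP[v [u [vq ->]]]; exists 1%N, (fun=> u), (fun=> v).
  by rewrite big_ord1 mulrC.
move=> [n [s [x [xq ->]]]]; apply: (big_ind (fun y => y \in extended q)).
- exact: spec0.
- exact: specD.
- by move=> j _; apply/extendedP; exists (x j), (s j); rewrite mulrC.
Qed.

Lemma spec_map_extended (q : spec V) : spec_map beta (extended q) = q.
Proof.
apply: spec_eqP => v; apply/idP/idP => [/extendedP[v' [u [v'q vE]]]|vq].
  by have [c ->] := monomial_dvd vE; rewrite mulrC specM.
by apply/extendedP; exists v, 1; rewrite mulr1.
Qed.

Lemma extended_spec_map (q' : spec W) : extended (spec_map beta q') = q'.
Proof.
apply: spec_eqP => y; apply/extendedP/idP => [[v [u [vq ->]]]|].
  by rewrite mulrC specM.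
have [v [u [uu ->]]] := W_monomial y => /(spec_unitM uu) vq.
by exists v, u.
Qed.

(** The zero locus of a subset of W is the preimage of a zero locus in Spec V:
    each element is replaced by its factor in V. *)
Theorem monomial_homeomorphism : homeomorphism (spec_map beta).
Proof.
split.
- by exists extended; [exact: extended_spec_map|exact: spec_map_extended].
- apply/continuousP => U [E ->]; exists (beta @` E)%classic.
  apply/seteqP; split=> q' nh h; apply: nh.
    by move=> v Ev; apply: (h (beta v)); exists v.
  by move=> _ [v Ev <-]; exact: (h v Ev).
- move=> U [E ->]; exists [set v | exists2 u, u \is a GRing.unit & E (beta v * u)]%classic.
  apply/seteqP; split=> q.
    move=> [q' q'E <-] h; apply: q'E => y Ey; have [v [u [uu yE]]] := W_monomial y.
    have /h vq : exists2 u, u \is a GRing.unit & E (beta v * u) by exists u; rewrite -?yE.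
    by rewrite yE mulrC specM.
  move=> qE; exists (extended q); last exact: spec_map_extended.
  move=> h; apply: qE => v [u uu Evu].
  rewrite -(spec_map_extended q); exact: (spec_unitM uu (h _ Evu)).
Qed.

End MonomialExtension.

(** * Residue fields *)

Lemma residue_ker (R : comNzRingType) (p : spec R) (K : fieldType) (f : {rmorphism R -> K}) x :
  residue_field_at p f -> (x \in p) = (f x == 0).
Proof. by move=> [<- _]. Qed.

(** The local ring of R at p, being a field, is the residue field. *)
Lemma residue_localizes (R : comNzRingType) (p : spec R) (K : fieldType) (f : {rmorphism R -> K}) :
  residue_field_at p f -> strictly_maximal p -> localizes f.
Proof.
move=> fres [Q [g [g_unit g_frac g_eq]]]; have fE x := residue_ker x fres.
split=> [y|x /eqP]; first by have [_ /(_ y)[x [s [s0 ->]]]] := fres; exists x, s.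
rewrite -fE => xp; have gx : g x = g 0.
  rewrite rmorph0; apply/eqP; apply: contraT => gx0.
  have [y [s [sp E]]] := g_frac (g x)^-1.
  have gs0 : g s != 0 by rewrite -unitfE g_unit.
  have [|t tp tE] := g_eq (x * y) s.
    by rewrite rmorphM -[g y](divfK gs0) -E mulrA divff ?mul1r.
  have : t * s \in p by rewrite -tE [x * y]mulrC; do 2!apply: specM.
  by move=> /spec_mulr[] /idPn; rewrite ?(negPf tp) ?(negPf sp).
by have [s sp] := g_eq _ _ gx; rewrite mulr0 => sx; exists s; rewrite // -fE.
Qed.

Section Composite.
Variables (k k' Kq E : fieldType) (V W : comUnitRingType) (V' : comNzRingType).
Variables (i : {rmorphism k -> V}) (phi : {rmorphism k -> k'}).
Variables (a : {rmorphism k' -> V'}) (b : {rmorphism V -> V'}) (l : {rmorphism V' -> W}).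
Variables (p : spec V') (q : spec V) (q' : spec W).
Variables (c : {rmorphism V -> Kq}) (d : {rmorphism W -> E}) (v : {rmorphism Kq -> E}).
Hypothesis V'_tensor : tensor_product phi i a b.
Hypothesis W_loc : localization_at p l.
Hypothesis q'_gen : forall y, y \in q' -> exists x u, x \in q /\ y = l (b x) * u.
Hypothesis c_residue : residue_field_at q c.
Hypothesis d_residue : residue_field_at q' d.
Hypothesis v_c : v \o c =1 d \o (l \o b).

Lemma composite_fraction y : exists x s, d (l s) != 0 /\ y = d (l x) / d (l s).
Proof.
have [l_unit l_frac _] := W_loc.
have [_ /(_ y)[w1 [w2 [w20 ->]]]] := d_residue.
have [x1 [s1 [/l_unit s1u w1E]]] := l_frac w1; have [x2 [s2 [/l_unit s2u w2E]]] := l_frac w2.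
have ds w : w \is a GRing.unit -> d w != 0 by rewrite -unitfE; apply: rmorph_unit.
have dx2 : d (l x2) != 0.
  by apply: contra_neq w20 => x20; rewrite w2E rmorphM x20 mul0r.
exists (x1 * s2), (s1 * x2); split; first by rewrite !rmorphM mulf_neq0 // ds.
by rewrite w1E w2E !(rmorphM d) !(rmorphV d) // invf_div mulf_div !rmorphM.
Qed.

Lemma composite_generated : composite_ext phi (c \o i) (d \o (l \o a)) v.
Proof.
split=> [x|S S_dr Sa Sv y].
  by rewrite -[RHS]/((v \o c) (i x)) v_c /= (tensor_comm V'_tensor).
pose S' : divringClosed E := HB.pack S (GRing.isDivringClosed.Build _ _ S_dr).
have S'E : S' =i S by [].
have dl x : d (l x) \in S'.
  have [s ->] := tensor_span V'_tensor x; rewrite !rmorph_sum rpred_sum // => z _.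
  rewrite !rmorphM rpredM //; first exact: Sa.
  by rewrite -[d _]/((d \o (l \o b)) z.2) -v_c; exact: Sv.
have [x [s [_ ->]]] := composite_fraction y.
by rewrite -S'E rpred_div.
Qed.

(** An element t of k' (x) Kq comes, up to a unit, from some t0 in V'. If h
    kills t then l t0 lies in q', hence is a multiple of some x in q; clearing
    denominators, a multiple s t0 with l s a unit is a multiple of b x and so
    vanishes in k' (x) Kq. *)
Lemma composite_tensor : exists (T : comNzRingType)
    (aT : {rmorphism k' -> T}) (bT : {rmorphism Kq -> T}) (h : {rmorphism T -> E}),
  [/\ tensor_product phi (c \o i) aT bT, h \o aT =1 d \o (l \o a), h \o bT =1 v
    & localizes h].
Proof.
have [T [aT [bT Tt]]] := tensor_exists phi (c \o i).
have [h [hE1 hE2]] := tensor_rmorphism Tt composite_generated.1.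
exists T, aT, bT, h; split=> //.
have [tau [tauE1 tauE2]] := tensor_rmorphism V'_tensor (f := aT) (g := bT \o c)
  (tensor_comm Tt).
have htau x : h (tau x) = d (l x).
  have [s ->] := tensor_span V'_tensor x; rewrite !rmorph_sum; apply: eq_bigr => z _.
  rewrite !rmorphM tauE1 tauE2 /= hE1 hE2; congr (_ * _); exact: v_c.
split=> [y|t ht].
  have [x [s [s0 ->]]] := composite_fraction y.
  by exists (tau x), (tau s); rewrite !htau.
have [v0 [t0 [v00 tE]]] : exists v0 t0, c v0 != 0 /\ bT (c v0) * t = tau t0.
  have [s ->] := tensor_span Tt t; elim: s {ht} => [|z s [w [u [w0 wE]]]].
    by exists 1, 0; rewrite big_nil mulr0 !rmorph0 rmorph1 oner_eq0.
  have [_ /(_ z.2)[x1 [x2 [x20 zE]]]] := c_residue.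
  exists (x2 * w), (a z.1 * b (w * x1) + b x2 * u); split.
    by rewrite rmorphM mulf_neq0.
  rewrite big_cons mulrDr rmorphD; congr (_ + _).
    rewrite rmorphM tauE1 tauE2 /= zE mulrCA -rmorphM; congr (_ * bT _).
    by rewrite !rmorphM mulrC mulrA divfK // mulrC.
  by rewrite (rmorphM tau) tauE2 /= -wE !rmorphM mulrA.
have lt0 : l t0 \in q'.
  by rewrite (residue_ker _ d_residue) -htau -tE rmorphM ht mulr0.
have [l_unit l_frac l_eq] := W_loc.
have [x [u [xq lE]]] := q'_gen lt0.
have [y [s [sp uE]]] := l_frac u; have su := l_unit s sp.
have [|s' s'p s'E] := l_eq (t0 * s) (b x * y).
  by rewrite !rmorphM lE uE mulrA divrK.
have s'u := l_unit s' s'p.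
exists (tau (s' * s) * bT (c v0)).
  rewrite rmorphM mulf_neq0 //.
    by rewrite htau -unitfE rmorphM; apply: rmorph_unit; rewrite unitrM s'u.
  by rewrite hE2 fmorph_eq0.
rewrite -mulrA tE -rmorphM -mulrA [s * _]mulrC s'E !rmorphM tauE2 /=.
have /eqP-> : c x == 0 by rewrite -(residue_ker _ c_residue).
by rewrite rmorph0 mul0r mulr0.
Qed.

End Composite.

(** Reduction modulo the maximal ideal detects nilpotents of kappa(q) (x) N:
    up to a scalar such an element has coefficients in V, one of them being 1,
    and with as few terms as possible the corresponding left factor is not in
    the span of the others, so that the reduction is not zero. *)
Lemma residue_separable (k F Kq : fieldType) (V : comUnitRingType)
    (i : {rmorphism k -> V}) (r : {rmorphism V -> F}) (q : spec V)
    (c : {rmorphism V -> Kq}) :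
    valuation_ring V -> residue_field_of_local r -> residue_field_at q c ->
  separable_ext (r \o i) -> separable_ext (c \o i).
Proof.
move=> V_val [r_unit _] c_res sepF N chi; have [_ V_total] := valuation_ringP V_val.
have cE x := residue_ker x c_res.
have [TF [aF [bF [TFt TFred]]]] := sepF N chi.
have [T [al [be Tt]]] := tensor_exists (c \o i) chi.
have [TV [aV [bV TVt]]] := tensor_exists i chi.
exists T, al, be; split=> //.
have [piF [piFa piFb]] := tensor_rmorphism TVt (f := aF \o r) (g := bF) (tensor_comm TFt).
have [piq [piqa piqb]] := tensor_rmorphism TVt (f := al \o c) (g := be) (tensor_comm Tt).
have piqF t : piq t = 0 -> piF t = 0.
  move=> t0; have [|s s0 ->] := tensor_kernel (tensor_sym TVt) (tensor_sym Tt) (u := c) _ piqb piqa t0.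
    by [].
  rewrite rmorph_sum big_seq big1 // => z zs; rewrite rmorphM piFa /=.
  have /eqP-> : r z.2 == 0; last by rewrite rmorph0 mulr0.
  by rewrite r_unit (@spec_nonunit _ q) // cE s0 ?map_f.
have main n m (s : seq (N * V)) : (size s <= m)%N ->
    piq (\sum_(z <- s) bV z.1 * aV z.2) ^+ n = 0 -> piq (\sum_(z <- s) bV z.1 * aV z.2) = 0.
  elim: m s => [|m IH] s; first by rewrite leqn0 size_eq0 => /eqP->; rewrite big_nil rmorph0.
  move=> sm sn; have [s_nil|s0] := eqVneq s [::]; first by rewrite s_nil big_nil rmorph0.
  have [|||||z zs zmin] := @least_element _ (fun=> True)
      (fun x y : N * V => exists c, y.2 = c * x.2) s.
  - by move=> x _; exists 1; rewrite mul1r.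
  - by move=> x y t [e ->] [f ->]; exists (f * e); rewrite mulrA.
  - by move=> x y _ _; have [] := V_total x.2 y.2; [right|left].
  - by [].
  - by [].
  have /choice[e eP] : forall x, exists e, x \in s -> x.2 = e * z.2.
    by move=> x; have [/zmin[e]|] := boolP (x \in s); [exists e|exists 0].
  have [z0|z0] := eqVneq (c z.2) 0.
    rewrite rmorph_sum big_seq big1 // => x xs.
    by rewrite rmorphM piqa (eP _ xs) /= rmorphM z0 mulr0 rmorph0 mulr0.
  have ps : perm_eq s (z :: rem z s) := perm_to_rem zs.
  pose rest := [seq (x.1, e x) | x <- rem z s].
  pose t' := bV z.1 + \sum_(x <- rest) bV x.1 * aV x.2.
  have tE : \sum_(x <- s) bV x.1 * aV x.2 = t' * aV z.2.
    rewrite (perm_big _ ps) big_cons mulrDl; congr (_ + _).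
    rewrite big_map mulr_suml !big_seq; apply: eq_bigr => x /mem_rem xs /=.
    by rewrite -mulrA -rmorphM -eP.
  have z_reg x y : y != 0 -> x * al y = 0 -> x = 0.
    move=> y0 /(congr1 ( *%R^~ (al y^-1))).
    by rewrite mul0r -mulrA -rmorphM divff // rmorph1 mulr1.
  have t'n : piq (t' ^+ n) = 0.
    rewrite rmorphXn; apply: (z_reg _ (c z.2 ^+ n)); first by rewrite expf_neq0.
    by move: sn; rewrite tE rmorphM piqa /= exprMn rmorphXn.
  have piF0 : piF t' = 0 by apply: (TFred _ n); rewrite -rmorphXn piqF.
  rewrite tE rmorphM (_ : piq t' = 0) ?mul0r //.
  (* If z.1 is in the span of the others the list can be shortened; otherwise a
     functional that isolates it shows that piF t' is not zero. *)
  have [z_span|z_free] := pselect (in_span (image_of chi) (map fst rest) z.1).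
    have [sc scE] := scalar_part chi.
    have [s' ss' s'E] := absorb_span (fun x (y : V) => i (sc x) * y) 1 z_span.
    have t'E : t' = \sum_(x <- s') bV x.1 * aV x.2.
      rewrite (s'E _ (fun x y => bV x * aV y)) ?rmorph1 ?mulr1 //.
      split=> [x y w|y x w|_ /image_ofP[f ->] x y]; rewrite ?rmorphD ?mulrDr ?mulrDl //.
      by rewrite scE !rmorphM (tensor_comm TVt) mulrCA mulrA.
    rewrite t'E; apply: IH; last by rewrite -t'E -rmorphXn.
    by rewrite ss' size_map size_rem // -ltnS prednK // lt0n size_eq0.
  have [lam [flam lamz lam0]] := exists_functional (image_subfield chi)
    (in_span0 (image_subfield chi) _) (@in_spanD _ _ (image_subfield chi) _)
    (fun f y fS => @in_spanZ _ _ (image_subfield chi) _ f y fS) z_free.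
  have [mu muE [muD muZ]] := functional_scalar flam.
  have mu0 x : lam x = 0 -> mu x = 0.
    by rewrite muE => /eqP; rewrite fmorph_eq0 => /eqP.
  have [|g gE _] := @tensor_contract _ _ _ _ _ _ _ _ (tensor_sym TFt) ((r \o i) \o mu).
    by split=> [x y|f x] /=; rewrite ?muD ?muZ ?(rmorphD, rmorphM).
  have /eqP := congr1 g piF0; rewrite !rmorphD raddfD raddf0 rmorph_sum raddf_sum.
  rewrite big_seq big1 => [|x xs].
    rewrite addr0 piFb -[bF _]mulr1 -(rmorph1 aF) gE mulr1 /=.
    suff -> : mu z.1 = 1 by rewrite !rmorph1 oner_eq0.
    by apply: (fmorph_inj chi); rewrite -muE lamz rmorph1.
  rewrite rmorphM piFa piFb gE /= mu0 ?rmorph0 ?mul0r //.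
  by apply: lam0; apply: in_span_mem; [exact: image_subfield|exact: map_f].
move=> t n tn.
have [y [s [y0 E]]] : exists y (s : seq (N * V)), y != 0 /\
    t * al y = piq (\sum_(z <- s) bV z.1 * aV z.2).
  have [s ->] := tensor_span Tt t; elim: s {tn} => [|z s [y [s' [y0 E]]]].
    by exists 1, [::]; rewrite !big_nil mul0r rmorph0 oner_eq0.
  have [_ /(_ z.1)[x1 [x2 [x20 zE]]]] := c_res; have [_ /(_ y)[y1 [y2 [y20 yE]]]] := c_res.
  have cy1 : c y1 != 0 by apply: contra_neq y0 => cy; rewrite yE cy mul0r.
  exists (c (y1 * x2)), ((z.2, x1 * y1) :: [seq (x.1, x2 * y2 * x.2) | x <- s']).
  split; first by rewrite rmorphM mulf_neq0.
  rewrite !big_cons big_map mulrDl [RHS]rmorphD; congr (_ + _).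
    rewrite rmorphM piqb piqa /= mulrAC mulrC -rmorphM; congr (_ * al _).
    by rewrite zE !rmorphM [c y1 * _]mulrC mulrA divfK.
  have -> : c (y1 * x2) = y * c (x2 * y2).
    by rewrite yE !rmorphM [c x2 * _]mulrC mulrA divfK.
  rewrite rmorphM mulrA E -[al _]/((al \o c) _) -piqa -rmorphM mulr_suml; congr (piq _).
  by apply: eq_bigr => x _ /=; rewrite -mulrA -rmorphM [x.2 * _]mulrC.
have : t * al y = 0.
  by rewrite E; apply: (main n _ _ (leqnn _)); rewrite -E exprMn tn mul0r.
by move/(congr1 ( *%R^~ (al y^-1))); rewrite mul0r -mulrA -rmorphM divff // rmorph1 mulr1.
Qed.

(** * The theorem *)

(** The kernel of V' -> F' is generated by the maximal ideal of V, and finitely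
    many elements of that ideal have one of them as a common divisor. *)
Lemma reduction_kernel (k k' F : fieldType) (V : comUnitRingType) (V' F' : comNzRingType)
    (i : {rmorphism k -> V}) (phi : {rmorphism k -> k'}) (r : {rmorphism V -> F})
    (a : {rmorphism k' -> V'}) (b : {rmorphism V -> V'})
    (a' : {rmorphism k' -> F'}) (b' : {rmorphism F -> F'}) (rho : {rmorphism V' -> F'}) t :
    valuation_ring V -> residue_field_of_local r ->
    tensor_product phi i a b -> tensor_product phi (r \o i) a' b' ->
    rho \o a =1 a' -> rho \o b =1 b' \o r -> rho t = 0 ->
  exists c z, c \isn't a GRing.unit /\ t = b c * z.
Proof.
move=> V_val [r_unit _] V't F't rho_a rho_b t0.
have [_ V_total] := valuation_ringP V_val.
have [//|s s0 ->] := tensor_kernel V't F't (u := r) _ rho_a rho_b t0.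
have [->|s_nil] := eqVneq s [::].
  by exists 0, 0; rewrite big_nil mulr0 unitr0.
have [|||||x xs xmin] := @least_element _ (fun=> True)
    (fun x y : k' * V => exists c, y.2 = c * x.2) s.
- by move=> x _; exists 1; rewrite mul1r.
- by move=> x y z [e ->] [f ->]; exists (f * e); rewrite mulrA.
- by move=> x y _ _; have [] := V_total x.2 y.2; [right|left].
- by [].
- by [].
have /choice[e eP] : forall y, exists e, y \in s -> y.2 = e * x.2.
  by move=> y; have [/xmin[e]|] := boolP (y \in s); [exists e|exists 0].
exists x.2, (\sum_(y <- s) a y.1 * b (e y)); split; first by rewrite -r_unit s0 ?map_f.
rewrite mulr_sumr !big_seq; apply: eq_bigr => y ys.
by rewrite (eP _ ys) rmorphM mulrA mulrC.
Qed.

Theorem mainTheorem4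
    (k k' : fieldType) (V : comUnitRingType)
    (i : {rmorphism k -> V}) (phi : {rmorphism k -> k'})
    (V_valuation : valuation_ring V)
    (F : fieldType) (r : {rmorphism V -> F})
    (F_residue : residue_field_of_local r)
    (V' : comNzRingType) (a : {rmorphism k' -> V'}) (b : {rmorphism V -> V'})
    (V'_tensor : tensor_product phi i a b)
    (F' : comNzRingType) (a' : {rmorphism k' -> F'}) (b' : {rmorphism F -> F'})
    (F'_tensor : tensor_product phi (r \o i) a' b')
    (rho : {rmorphism V' -> F'})
    (rho_a : rho \o a =1 a') (rho_b : rho \o b =1 b' \o r)
    (pbar : spec F') (pbar_minimal : minimal_prime pbar)
    (p : spec V') (p_pbar : p = spec_map rho pbar)
    (x_strictly_maximal : strictly_maximal pbar)
    (W : comUnitRingType) (l : {rmorphism V' -> W})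
    (W_loc : localization_at p l)
    (kx : fieldType) (e : {rmorphism F' -> kx})
    (kx_residue : residue_field_at pbar e) :
  [/\ weakly_unramified_extension (l \o b),
      homeomorphism (spec_map (l \o b)) /\
      (forall q : spec V, exists q' : spec W,
        [/\ [set y | y \in q']%classic = extension_ideal (l \o b) q,
            forall q'' : spec W, spec_map (l \o b) q'' = q <-> q'' = q'
          & forall (Kq E : fieldType)
                   (c : {rmorphism V -> Kq}) (d : {rmorphism W -> E}),
              residue_field_at q c -> residue_field_at q' d ->
              exists2 v : {rmorphism Kq -> E},
                v \o c =1 d \o (l \o b)
                & strictly_maximal_composite phi (c \o i) (d \o (l \o a)) v]),
      separable_ext phi ->
        separable_ext (e \o b') /\
        (forall (q : spec V) (q' : spec W) (Kq E : fieldType)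
                (c : {rmorphism V -> Kq}) (d : {rmorphism W -> E})
                (v : {rmorphism Kq -> E}),
           [set y | y \in q']%classic = extension_ideal (l \o b) q ->
           residue_field_at q c -> residue_field_at q' d ->
           v \o c =1 d \o (l \o b) -> separable_ext v)
    & separable_ext (r \o i) ->
        separable_ext (e \o a') /\
        (forall (q' : spec W) (E : fieldType) (d : {rmorphism W -> E}),
           residue_field_at q' d -> separable_ext (d \o (l \o a)))].
Proof.
have [V_domain V_total] := valuation_ringP V_valuation.
have [r_unit r_surj] := F_residue.
have rho_surj y : exists x, rho x = y.
  have [s ->] := tensor_span F'_tensor y; elim: s => [|[x v] s [t tE]].
    by exists 0; rewrite rmorph0 big_nil.
  have [w wE] := r_surj v; exists (a x * b w + t).
  rewrite big_cons rmorphD rmorphM tE /= -[rho (a x)]/((rho \o a) x) rho_a.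
  by rewrite -[rho (b w)]/((rho \o b) w) rho_b /= wE.
have e_loc := residue_localizes kx_residue x_strictly_maximal.
pose eps : {rmorphism V' -> kx} := e \o rho.
have epsE x : (x \in p) = (eps x == 0).
  by rewrite p_pbar -(residue_ker _ kx_residue).
have p_eps : p = ker_point eps by apply: spec_eqP => x; rewrite epsE.
have W_loc' : localization_at (ker_point eps) l by rewrite -p_eps.
have eps_b v : (eps (b v) == 0) = (v \isn't a GRing.unit).
  by rewrite /= -[rho (b v)]/((rho \o b) v) rho_b /= -[e _]/((e \o b') _) fmorph_eq0.
have eps_strict y : eps y = 0 ->
    exists s c z, [/\ eps s != 0, c \isn't a GRing.unit & s * y = b c * z].
  move=> /e_loc.2[sbar]; have [s <-] := rho_surj sbar; rewrite -rmorphM => s0.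
  move=> /(reduction_kernel V_valuation F_residue V'_tensor F'_tensor rho_a rho_b)[c [z [cu E]]].
  by exists s, c, z.
pose beta : {rmorphism V -> W} := l \o b.
have W_monomial y : exists v u, u \is a GRing.unit /\ y = beta v * u.
  have [x [s [s0 ->]]] := loc_frac W_loc' y.
  have [v [u [uu ->]]] :=
    localization_monomial V'_tensor V_total V_domain W_loc' eps_b eps_strict x.
  exists v, (u / l s); split; last by rewrite mulrA.
  by rewrite unitrM uu unitrV (loc_unit W_loc').
have beta_local v : (beta v \is a GRing.unit) = (v \is a GRing.unit).
  exact: (beta_unit W_loc' eps_b).
have beta_reg v y : v != 0 -> beta v * y = 0 -> y = 0.
  exact: (beta_regular V'_tensor V_domain W_loc').
pose ext := extended V_valuation W_monomial beta_local beta_reg.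
have extE q := extended_extension V_valuation W_monomial beta_local beta_reg q.
have spec_ext q := spec_map_extended V_valuation W_monomial beta_local beta_reg q.
have ext_spec q' := extended_spec_map V_valuation W_monomial beta_local beta_reg q'.
have ext_gen q y : y \in ext q -> exists x u, x \in q /\ y = l (b x) * u.
  by move=> /extendedP.
have ext_residue q (Kq E : fieldType) (c : {rmorphism V -> Kq}) (d : {rmorphism W -> E}) :
    residue_field_at q c -> residue_field_at (ext q) d ->
    exists v : {rmorphism Kq -> E}, v \o c =1 d \o beta.
  move=> cres dres; have [_ cfrac] := cres.
  apply: (fraction_extension (h := d \o beta) cfrac) => x /=.
  by rewrite -(residue_ker _ cres) -[in LHS](spec_ext q) -(residue_ker _ dres).
split.
- exact: monomial_weakly_unramified.
- split; first exact: monomial_homeomorphism.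
  move=> q; exists (ext q); split=> [|q''|Kq E c d cres dres]; first exact: extE.
    by split=> [<-|->]; [exact/esym/ext_spec|exact: spec_ext].
  have [v vE] := ext_residue q Kq E c d cres dres; exists v => //.
  split; first exact: (composite_generated V'_tensor W_loc dres vE).
  have [T [aT [bT [h [Tt hE1 hE2 /localizes_strictly_maximal h_max]]]]] :=
    composite_tensor V'_tensor W_loc (@ext_gen q) cres dres vE.
  by exists T, aT, bT, h.
- move=> sep; split; first exact: (separable_localizes F'_tensor e_loc _ sep).
  move=> q q' Kq E c d v q'E cres dres vE.
  have qE : q' = ext q.
    have /seteqP[h1 h2] := etrans q'E (esym (extE q)).
    by apply: spec_eqP => y; apply/idP/idP => [/h1|/h2].
  rewrite qE in dres.
  have [T [aT [bT [h [Tt hE1 hE2 h_loc]]]]] :=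
    composite_tensor V'_tensor W_loc (@ext_gen q) cres dres vE.
  by apply: (separable_localizes Tt h_loc _ sep) => x; rewrite hE2.
- move=> sep; split.
    exact: (separable_localizes (tensor_sym F'_tensor) e_loc _ sep).
  move=> q' E d dres; pose q := spec_map beta q'.
  have [Kq [c cres]] := residue_field_exists (d \o beta).
  have qE : ker_point (d \o beta) = q.
    by apply: spec_eqP => x; rewrite inE /= -(residue_ker _ dres).
  rewrite qE in cres; have dres' : residue_field_at (ext q) d by rewrite [ext q]ext_spec.
  have [v vE] := ext_residue q Kq E c d cres dres'.
  have [T [aT [bT [h [Tt hE1 hE2 h_loc]]]]] :=
    composite_tensor V'_tensor W_loc (@ext_gen q) cres dres' vE.
  apply: (separable_localizes (tensor_sym Tt) h_loc (hb := d \o (l \o a))).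
    by move=> x; rewrite hE1.
  exact: (residue_separable V_valuation F_residue cres sep).
Qed.
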